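(* Let $\beta\in\mathbb{R}$. The unique measure $\nu\in\mathcal{M}_{+,1}([0,1]^2)$ such that $\mathcal{I}_\beta(\nu)=0$ is $\nu=\nu_\beta^*$, where $d\nu_\beta^*(x,y)=\rho_\beta(x,y)\,dx\,dy$ for $(x,y)\in[0,1]^2$, with $$\rho_\beta(x,y)=\frac{\partial^2}{\partial x\,\partial y}R_\beta(x,y).$$
   Context: $\mathcal{M}_{+,1}([0,1]^2)$ is the set of Borel probability measures on $[0,1]^2$, and $\lambda^{\otimes 2}$ is Lebesgue measure on $[0,1]^2$. Relative entropy (negative of the Kullback–Leibler divergence): $S(\mu|\nu)=-\int\ln\left(\frac{d\mu}{d\nu}\right)d\mu$ if $\mu\ll\nu$, and $S(\mu|\nu)=-\infty$ otherwise. Energy: $\mathcal{E}(\nu)=\frac12\int_{[0,1]^2}\int_{[0,1]^2}h((x_1,y_1),(x_2,y_2))\,d\nu(x_1,y_1)\,d\nu(x_2,y_2)$, where $h((x_1,y_1),(x_2,y_2))=1$ if $(x_1-x_2)(y_1-y_2)<0$ and $0$ otherwise. Pressure: $p(\beta)=\int_0^1\ln\left(\frac{1-e^{-\beta x}}{\beta x}\right)dx$ for $\beta\in\mathbb{R}$, with the continuous extension $p(0)=0$. Rate function: $\mathcal{I}_\beta(\nu)=-S(\nu|\lambda^{\otimes 2})+\beta\mathcal{E}(\nu)+p(\beta)\in\mathbb{R}\cup\{+\infty\}$. $R_\beta(\theta_1,\theta_2)=-\frac1\beta\ln\left(1-\frac{(1-e^{-\beta\theta_1})(1-e^{-\beta\theta_2})}{1-e^{-\beta}}\right)$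 for $(\theta_1,\theta_2)\in[0,1]^2$, read as the limit $\theta_1\theta_2$ when $\beta=0$. *)

(* Defs.v *)
From HB Require Import structures.
From mathcomp Require Import all_boot all_order all_algebra.
From mathcomp Require Import all_classical all_reals all_analysis.

Set Implicit Arguments.
Unset Strict Implicit.
Unset Printing Implicit Defensive.
Import Order.TTheory GRing.Theory Num.Theory.
Import numFieldNormedType.Exports.

Local Open Scope classical_set_scope.
Local Open Scope ring_scope.
Local Open Scope ereal_scope.
Local Open Scope charge_scope.

(* A Borel measure on [0,1]^2 is represented by the measure it induces on the
   plane, so that the Borel probability measures on [0,1]^2 are the probability
   measures on the plane that give mass 1 to [0,1]^2.  A library measure is a
   function on all subsets, meaningful on the measurable ones only: two measures
   are the same when they agree on all measurable sets.  The sigma-algebra below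
   is the product of the Borel ones, i.e. the Borel sigma-algebra of the
   plane. *)
Notation plane R := (measurableTypeR R * measurableTypeR R)%type.

Section unit_square.
Context (R : realType).

Definition unit_square : set (plane R) := `[0%R, 1%R] `*` `[0%R, 1%R].

Definition square_prob (nu : probability (plane R) R) : Prop :=
  nu unit_square = 1.

Lemma measurable_unit_square : measurable unit_square.
Proof. by apply: measurableX; exact: measurable_itv. Qed.

Definition lebesgue_plane : {measure set (plane R) -> \bar R} :=
  lebesgue_measure \x lebesgue_measure.

Lemma lebesgue_unit_square : lebesgue_plane unit_square = 1.
Proof.
have leb01 : lebesgue_measure (`[0%R, 1%R] : set (measurableTypeR R)) = 1.
  by rewrite lebesgue_measure_itv/= lte_fin ltr01 oppr0 adde0.
transitivity (lebesgue_measure (`[0%R, 1%R] : set (measurableTypeR R)) *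
              lebesgue_measure (`[0%R, 1%R] : set (measurableTypeR R))).
  by apply: product_measure1E; exact: measurable_itv.
by rewrite leb01 mule1.
Qed.

Lemma lebesgue_unit_square_lty : lebesgue_plane unit_square < +oo.
Proof. by rewrite lebesgue_unit_square ltry. Qed.

Definition lebesgue_square : {sigma_finite_measure set (plane R) -> \bar R} :=
  mfrestr measurable_unit_square lebesgue_unit_square_lty.

End unit_square.
Arguments unit_square R : clear implicits.
Arguments lebesgue_square R : clear implicits.

Section rate_function.
Context {R : realType}.
Implicit Types (beta x y : R) (nu : probability (plane R) R).

(* [lne 0 = -oo], but d mu/d nu vanishes on a mu-null set only.  The negative
   part of ln (d mu/d nu) is mu-integrable when nu is finite, so that the
   integral makes sense in ]-oo, +oo]. *)
Definition relative_entropy d (T : measurableType d) (mu : probability T R)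
    (nu : {sigma_finite_measure set T -> \bar R}) : \bar R :=
  if `[< mu `<< nu >] then
    - \int[mu]_z lne (('d (charge_of_finite_measure mu) '/d nu) z)
  else -oo.

Definition inversion (p q : plane R) : R :=
  if ((p.1 - q.1) * (p.2 - q.2) < 0)%R then 1%R else 0%R.

Definition energy nu : \bar R :=
  (2^-1)%:E * \int[nu]_(p in unit_square R) \int[nu]_(q in unit_square R)
                 (inversion p q)%:E.

Definition pressure beta : R :=
  if beta == 0%R then 0%R else
  (\int[lebesgue_measure]_(x in `[0%R, 1%R])
     ln ((1 - expR (- (beta * x))) / (beta * x)))%R.

Definition rate_function beta nu : \bar R :=
  - relative_entropy nu (lebesgue_square R) + beta%:E * energy nu +
  (pressure beta)%:E.

(* Off [0,1]^2 the value is given by the same formula, which is smooth on a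
   neighbourhood of [0,1]^2: the derivatives in [rho] at boundary points of the
   square are thus two-sided and agree with the one-sided ones. *)
Definition R_ beta x y : R :=
  if beta == 0%R then (x * y)%R else
  (- beta^-1 * ln (1 - (1 - expR (- (beta * x))) * (1 - expR (- (beta * y)))
                       / (1 - expR (- beta))))%R.

Definition rho beta x y : R :=
  derive1 (fun x' : R => derive1 (R_ beta x') y) x.

End rate_function.

(* Main.v *)
(* Let u be a density of nu, F its distribution function, A(x) = F(x, 1),
   g(x, y) = int_0^x u(t, y) dt and m(y) = int_0^1 u(t, y) dt.  Since g is the
   derivative of F in y, the function w = e^(-beta A) g e^(beta F) / Z, where
   Z = (1 - e^(-beta A)) / beta, is a probability density in y for each x with
   A(x) > 0.  The energy is int (A - F) dnu and, by the probability integral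
   transform, A(x) and g(x, y) / m(y) are both uniform on [0,1] under nu: this
   evaluates int ln (Z / A) dnu as the pressure and cancels int ln A dnu against
   int ln (g / m) dnu.  With l(r) = r - 1 - ln r >= 0 the rate is therefore
     int (l(w / u) + l(1 / m)) dnu + (1 - int w / u dnu) + (1 - int 1 / m dnu),
   a sum of nonnegative terms, and it vanishes iff w = u and m = 1 nu-a.e.
   In that case A(x) = x, and integrating w = u in y shows that F satisfies
     d_x F = (e^(beta F) - 1) / (e^(beta x) - 1),  F(1, y) = y,
   whose only solution is R_beta; conversely the density of R_beta satisfies
   w = u and m = 1. *)

Require Import Defs.
From HB Require Import structures.
From mathcomp Require Import all_boot all_order all_algebra.
From mathcomp Require Import all_classical all_reals all_analysis.
From mathcomp Require Import measurable_realfun.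
From mathcomp Require Import ring lra.

Set Implicit Arguments.
Unset Strict Implicit.
Unset Printing Implicit Defensive.
Import Order.TTheory GRing.Theory Num.Theory.
Import numFieldNormedType.Exports.

Local Open Scope classical_set_scope.
Local Open Scope ring_scope.
Local Open Scope ereal_scope.

(** * Restrictions and densities of measures *)

(** The comparison density w is built from [nu] itself, and nothing but measurability is known of
    [u]. Changes of variable such as t = F(x, s), dt = g(x, s) ds are therefore made by pushing
    forward an atomless measure, not by differentiating F.

    Inverses and logarithms at 0 have the value 0. Where u, m or A vanishes, the mass identities for
    w / u and 1 / m thus become inequalities [<= 1], which is the direction that the argument needs.

    At a zero of the rate, w = u is obtained nu-a.e. only, which says nothing of w on a nu-null set.
    The gap is closed by comparing masses: nu A is at most the integral of w over A, likewise for
    the complement, and w has total mass at most 1.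

    The equation for F is singular at x = 0, so its solution is pinned down at x = 1. The condition
    there concerns the second marginal, and the term l(1 / m) is what provides it.

    At beta = 0 the formulas in 1 / beta degenerate. The rate is then the integral of ln u, and the
    argument is run with l(1 / u) alone. *)

Section integral_mrestr.
Context d (T : measurableType d) (R : realType).
Variables (mu : {measure set T -> \bar R}) (D : set T) (mD : measurable D).

Import HBNNSimple.

Let ge0_measurable_integral_mrestr (f : T -> \bar R) :
  measurable_fun setT f -> (forall x, 0 <= f x) ->
  \int[mrestr mu mD]_x f x = \int[mu]_(x in D) f x.
Proof.
move=> mf f0; rewrite -(setUv D) ge0_integral_setU//; last 3 first.
- exact: measurableC.
- by rewrite setUv.
- by rewrite disj_set2E setICr.
rewrite [X in _ + X](_ : _ = 0) ?adde0.
  apply: eq_measure_integral => A mA AD.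
  by rewrite /= /mrestr setIidl.
under eq_integral do rewrite -[f _]gee0_abs//.
apply: integral_abs_eq0 => //; first exact: measurableC.
  exact: measurable_funTS.
by rewrite /= /mrestr setICl measure0.
Qed.

(** The integral of a nonnegative function is a supremum over the simple functions below it, which
    reduces the claim to simple functions: one below [f] restricts to one below [f \_ D], and one
    below [f \_ D] vanishes off [D]. *)
Let ge0_integral_mrestr (f : T -> \bar R) : (forall x, 0 <= f x) ->
  \int[mrestr mu mD]_x f x = \int[mu]_(x in D) f x.
Proof.
move=> f0.
have fD0 x : 0 <= (f \_ D) x by exact: erestrict_ge0.
rewrite [RHS]integral_mkcond !ge0_integralTE//; apply/eqP; rewrite eq_le.
apply/andP; split; apply/ge_ereal_sup => _ [h /= hf <-].
  have -> : sintegral (mrestr mu mD) h = \int[mrestr mu mD]_x (h x)%:E.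
    by rewrite integral_nnsfun// patch_setT.
  have mh : measurable_fun setT (EFin \o h) by exact/measurable_EFinP.
  rewrite ge0_measurable_integral_mrestr//; last by move=> x; rewrite lee_fin.
  rewrite integral_nnsfun//; apply: ereal_sup_ubound => /=.
  exists (proj_nnsfun h mD) => [x|]; last by rewrite mrestrict.
  rewrite -mrestrict !patchE; case: ifPn => // xD; exact: hf.
have hD : h \_ D = h :> (T -> R).
  apply/funext => x; rewrite patchE; case: ifPn => // xD.
  apply/eqP; rewrite eq_le fun_ge0/= -lee_fin (le_trans (hf x))//.
  by rewrite patchE (negbTE xD).
have mh : measurable_fun setT (EFin \o h) by exact/measurable_EFinP.
rewrite -hD -integral_nnsfun// -ge0_measurable_integral_mrestr//; last first.
  by move=> x; rewrite lee_fin.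
rewrite integral_nnsfun// patch_setT; apply: ereal_sup_ubound => /=.
exists h => // x; apply: le_trans (hf x) _.
by rewrite patchE; case: ifPn.
Qed.

Lemma integral_mrestr (A : set T) (f : T -> \bar R) :
  \int[mrestr mu mD]_(x in A) f x = \int[mu]_(x in A `&` D) f x.
Proof.
rewrite [LHS]integral_mkcond [RHS]integral_mkcondl [LHS]integralE [RHS]integralE.
by congr (_ - _); apply: ge0_integral_mrestr.
Qed.

End integral_mrestr.

Section density.
Context d (T : measurableType d) (R : realType).
Variables (mu : {measure set T -> \bar R}) (f : T -> \bar R).

(** The proofs [mf] and [f0] are arguments so that the measure structure can be inferred from the
    term. *)
Definition mdensity (mf : measurable_fun setT f) (f0 : forall x, 0 <= f x) :=
  fun A => \int[mu]_(x in A) f x.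

Variables (mf : measurable_fun setT f) (f0 : forall x, 0 <= f x).

Let density0 : mdensity mf f0 set0 = 0.
Proof. exact: integral_set0. Qed.

Let density_ge0 A : 0 <= mdensity mf f0 A.
Proof. exact: integral_ge0. Qed.

Let density_sigma_additive : semi_sigma_additive (mdensity mf f0).
Proof.
move=> F mF tF mU; rewrite /mdensity ge0_integral_bigcup//.
  apply: is_cvg_ereal_nneg_natsum_cond => n _ _; exact: integral_ge0.
exact: measurable_funTS.
Qed.

HB.instance Definition _ := isMeasure.Build _ _ _ (mdensity mf f0)
  density0 density_ge0 density_sigma_additive.

End density.

Section integral_density.
Context d (T : measurableType d) (R : realType).
Variables (mu : {measure set T -> \bar R}) (nu : {measure set T -> \bar R}).
Variable u : T -> R.
Hypotheses (mu_ : measurable_fun setT u) (u0 : forall x, (0 <= u x)%R).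
Hypothesis nuE : forall A, measurable A -> nu A = \int[mu]_(x in A) (u x)%:E.

Import HBNNSimple.

Let mEu D : measurable_fun D (EFin \o u).
Proof. by apply/measurable_EFinP; exact: measurable_funTS. Qed.

(** On indicators this is [nuE]; it passes to simple functions by additivity and to [f] by monotone
    convergence on both sides. *)
Lemma ge0_integral_density D (f : T -> \bar R) : measurable D ->
  measurable_fun D f -> (forall x, D x -> 0 <= f x) ->
  \int[nu]_(x in D) f x = \int[mu]_(x in D) (f x * (u x)%:E).
Proof.
move=> mD mf f0.
pose h := nnsfun_approx mD mf.
have hE x : D x -> f x = lim ((EFin \o h n) x @[n --> \oo]).
  by move=> Dx; apply/esym/cvg_lim => //; exact: cvg_nnsfun_approx.
have hnd x a b : (a <= b)%N -> (h a x <= h b x)%R.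
  by move=> ab; exact/lefP/nd_nnsfun_approx.
under eq_integral => x /[!inE] /hE -> do [].
rewrite monotone_convergence//; last 3 first.
- by move=> n; apply/measurable_EFinP; exact: measurable_funTS.
- by move=> n x _; rewrite lee_fin.
- by move=> x _ a b ab; rewrite lee_fin hnd.
transitivity (\int[mu]_(x in D) (lim (((EFin \o h n) x * (u x)%:E) @[n --> \oo]))).
  rewrite monotone_convergence//; last 3 first.
  - move=> n; apply: emeasurable_funM => //.
    by apply/measurable_EFinP; exact: measurable_funTS.
  - by move=> n x _; rewrite mule_ge0 ?lee_fin.
  - by move=> x _ a b ab; rewrite lee_wpmul2r ?lee_fin// hnd.
  congr (limn _); apply/funext => n.
  under eq_integral do rewrite /= fimfunE -fsumEFin//.
  under [RHS]eq_integral.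
    move=> x _; rewrite /= fimfunE -fsumEFin// ge0_mule_fsuml; last first.
      by move=> r; exact: nnfun_muleindic_ge0.
    over.
  have mind (m : {measure set T -> \bar R}) r :
      measurable_fun D (fun x => (r * \1_(h n @^-1` [set r]) x)%:E).
    by apply/measurable_EFinP; apply: measurable_funM => //;
       exact/measurable_funTS/measurable_indic.
  rewrite !ge0_integral_fsum//; last 4 first.
  - by move=> r; apply: emeasurable_funM => //; exact: (mind mu).
  - by move=> r x _; rewrite mule_ge0 ?lee_fin// -lee_fin nnfun_muleindic_ge0.
  - by move=> r; exact: (mind mu).
  - by move=> r x _; rewrite nnfun_muleindic_ge0.
  apply: eq_fsbigr => r; rewrite inE => -[t _ <-].
  rewrite integralZl_indic_nnsfun//.
  under [RHS]eq_integral do rewrite EFinM -muleA.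
  rewrite ge0_integralZl//; last 3 first.
  - apply: emeasurable_funM => //.
    by apply/measurable_EFinP; exact/measurable_funTS/measurable_indic.
  - by move=> x _; rewrite mule_ge0 ?lee_fin.
  - by rewrite lee_fin.
  congr (_ * _); rewrite integral_indic// nuE; last exact: measurableI.
  rewrite setIC integral_mkcondr; apply: eq_integral => x _.
  by rewrite epatch_indic muleC.
apply: eq_integral => x /[!inE] Dx; rewrite limeMr//.
  by rewrite -hE.
apply: ereal_nondecreasing_is_cvgn => a b ab; rewrite lee_fin hnd//.
Qed.

End integral_density.

Lemma measureI_conull d (T : measurableType d) (R : realType)
    (m : {measure set T -> \bar R}) (A B : set T) :
  measurable A -> measurable B -> m (~` A) = 0 -> m (B `&` A) = m B.
Proof.
move=> mA mB mA0; apply/eqP; rewrite eq_le measureIl//=.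
rewrite -{1}(setIT B) -(setUv A) setIUr.
rewrite (le_trans (measureU2 _ _ _))//; try exact: measurableI.
  by apply: measurableI => //; exact: measurableC.
rewrite [X in _ + X](_ : _ = 0) ?adde0//; apply/eqP.
by rewrite -measure_le0 -mA0 measureIr//; exact: measurableC.
Qed.

Lemma measurable_invr (R : realType) : measurable_fun setT (@GRing.inv R).
Proof.
rewrite -(setUv [set 0%R : R]); apply/measurable_funU => //.
  exact: measurableC.
split.
  apply: eq_measurable_fun (measurable_cst (0%R : R)) => x.
  by rewrite inE => ->; rewrite invr0.
apply: open_continuous_measurable_fun.
  by apply: closed_openC; exact: closed_eq.
by move=> x; rewrite inE => /eqP x0; exact: inv_continuous.
Qed.

(** * The probability integral transform *)

Section cumulative_mass.
Context (R : realType) (m : {measure set (measurableTypeR R) -> \bar R}).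
Hypothesis m_lty : m setT < +oo.

Let m_fin A : measurable A -> m A \is a fin_num.
Proof.
move=> mA; rewrite ge0_fin_numE// (le_lt_trans _ m_lty)// le_measure ?inE//.
Qed.

Definition cmass (r : R) : R := fine (m `]-oo, r]%classic).

Lemma cmassE r : (cmass r)%:E = m `]-oo, r]%classic.
Proof. by rewrite fineK// m_fin. Qed.

Lemma cmass_ge0 r : (0 <= cmass r)%R.
Proof. by rewrite fine_ge0. Qed.

Lemma cmass_nd : {homo cmass : x y / (x <= y)%R}.
Proof.
move=> x y xy; rewrite -lee_fin !cmassE le_measure ?inE//.
exact: subset_itvl.
Qed.

Lemma measurable_cmass : measurable_fun setT cmass.
Proof. exact: nondecreasing_measurable cmass_nd. Qed.

Hypothesis noatom : forall r, m [set r] = 0.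

(** Within the interval [J n] around [r] the increments of [cmass] are at most [m (J n)], which
    tends to [m [set r] = 0] as the intervals shrink to [r]. *)
Lemma cmass_continuous : continuous cmass.
Proof.
move=> r; apply/cvgrPdist_le => /= e e0.
pose J n : set (measurableTypeR R) := `[(r - n.+1%:R^-1)%R, (r + n.+1%:R^-1)%R]%classic.
have Ir : \bigcap_n J n = [set r].
  apply/seteqP; split => [x xI|x -> n _]; last first.
    by rewrite /J /= in_itv/= lerBlDr !lerDl !invr_ge0 ler0n.
  apply/eqP; rewrite eq_le; apply/andP; split; apply/ler_addgt0Pr => d d0.
  - have [n _ /(_ n (leqnn n)) /= nd] := near_infty_natSinv_lt (PosNum d0).
    move: (xI n I); rewrite /J /= in_itv/= => /andP[_ xr].
    by rewrite (le_trans xr)// lerD2l ltW.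
  - have [n _ /(_ n (leqnn n)) /= nd] := near_infty_natSinv_lt (PosNum d0).
    move: (xI n I); rewrite /J /= in_itv/= => /andP[xr _].
    by rewrite -lerBlDr (le_trans _ xr)// lerB// ltW.
have mbJ n : measurable (J n) by exact: measurable_itv.
have mJ : m (J n) @[n --> \oo] --> 0.
  rewrite -(noatom r) -Ir; apply: nonincreasing_cvg_mu => //.
  - by rewrite -ge0_fin_numE// m_fin//; exact: measurable_itv.
  - by rewrite Ir; exact: measurable_set1.
  - move=> a b ab; apply/subsetPset => x; rewrite /J /= !in_itv/= => /andP[h1 h2].
    have ba : (b.+1%:R^-1 <= a.+1%:R^-1 :> R)%R.
      by rewrite lef_pV2 ?posrE// ler_nat.
    by rewrite (le_trans _ h1) ?lerB// (le_trans h2)// lerD2l.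
have [n _ /(_ n (leqnn n)) /= nJ] : \forall n \near \oo, m (J n) < e%:E.
  by apply: (mJ (fun x => x < e%:E)); apply: open_ereal_lt'; rewrite lte_fin.
have sub x y : (x <= y)%R -> x \in J n -> y \in J n ->
    (cmass y - cmass x <= e)%R.
  rewrite !inE /J/= !in_itv/= => xy /andP[x1 x2] /andP[y1 y2].
  rewrite lerBlDl -lee_fin EFinD !cmassE.
  apply: (@le_trans _ _ (m (`]-oo, x] `|` J n)%classic)).
    rewrite le_measure ?inE//; first by apply: measurableU => //; exact: measurable_itv.
    move=> z /=; rewrite /J /= !in_itv/= => zy.
    have [zx|xz] := leP z x; [by left|right].
    by rewrite (le_trans x1 (ltW xz)) (le_trans zy).
  apply: (le_trans (measureU2 _ _ _)) => //.
  by rewrite leeD2l ?ltW.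
near=> s.
have n0 : (0 < n.+1%:R^-1 :> R)%R by rewrite invr_gt0.
have rs : (`|r - s| <= n.+1%:R^-1)%R.
  by near: s; exact: cvgr_dist_le.
have rJ : r \in J n by rewrite inE /J /= in_itv/= lerBlDr !lerDl ltW.
have sJ : s \in J n.
  by move: rs; rewrite inE /J /= in_itv/= ler_distlC.
have [sr|rs'] := leP s r.
  by rewrite ger0_norm ?subr_ge0 ?cmass_nd// sub.
rewrite distrC ger0_norm ?subr_ge0; last by rewrite cmass_nd ?ltW.
by apply: sub => //; exact: ltW.
Unshelve. all: by end_near. Qed.

Hypotheses (m0 : m `]-oo, 0%R]%classic = 0)
  (m1 : m `]-oo, 1%R]%classic = m setT).

Let M := fine (m setT).

Let cmass_surj t : (0 <= t <= M)%R -> exists s, cmass s = t.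
Proof.
move=> tM.
have [|||s _ <-] := @IVT R cmass 0%R 1%R t; [by []| | |by exists s].
  exact/continuous_subspaceT/cmass_continuous.
have c0 : cmass 0 = 0%R by rewrite /cmass m0.
have c1 : cmass 1 = M by rewrite /cmass m1.
have M0 : (0 <= M)%R by case/andP: tM => /le_trans /[apply].
by rewrite c0 c1 min_l// max_r.
Qed.

(** The sublevel set lies in a ray ending at some [s] with [cmass s = t], and contains rays ending
    where [cmass] is slightly below [t]. Both points exist by continuity, and flat stretches of
    [cmass] do not matter. *)
Let m_cmass_lt t : (0 < t <= M)%R -> m [set x | (cmass x < t)%R] = t%:E.
Proof.
move=> /andP[t0 tM].
have mlt : measurable ([set x | (cmass x < t)%R] : set (measurableTypeR R)).
  rewrite (_ : [set _ | _] = cmass @^-1` `]-oo, t[%classic); last first.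
    by apply/seteqP; split => x /=; rewrite in_itv.
  by rewrite -[X in measurable X]setTI; apply: measurable_cmass.
have mle s : measurable (`]-oo, s]%classic : set (measurableTypeR R)).
  exact: measurable_itv.
apply/eqP; rewrite eq_le; apply/andP; split.
  have [|s st] := cmass_surj (t := t); first by rewrite ltW.
  apply: (@le_trans _ _ (m `]-oo, s]%classic)); last by rewrite -cmassE st.
  rewrite le_measure ?inE// => x /=; rewrite in_itv/= => xt.
  by rewrite leNgt; apply/negP => /ltW/cmass_nd; rewrite st leNgt xt.
apply/lee_addgt0Pr => e e0.
have [|s st] := cmass_surj (t := Num.max 0%R (t - e)%R).
  by rewrite le_max lexx/= ge_max (le_trans (ltW t0))//= (le_trans _ tM)// gerBl ltW.
rewrite -leeBlDr//; apply: (@le_trans _ _ (m `]-oo, s]%classic)).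
  by rewrite -cmassE st -EFinB lee_fin le_max lexx orbT.
rewrite le_measure ?inE// => x /=; rewrite in_itv/= => /cmass_nd.
move=> /le_lt_trans; apply; rewrite st gt_max t0/= ltrBlDr ltrDl//.
Qed.

(* Probability integral transform: an atomless cumulative mass function pushes
   its measure forward to Lebesgue measure. *)
Lemma ge0_integral_cmass (phi : measurableTypeR R -> \bar R) :
  measurable_fun setT phi -> (forall x, 0 <= phi x) ->
  \int[m]_x phi (cmass x) = \int[lebesgue_measure]_(t in `[0%R, M]) phi t.
Proof.
move=> mphi phi0.
pose c : measurableTypeR R -> measurableTypeR R := cmass.
have mc : measurable_fun setT c := measurable_cmass.
have mD : measurable (`[0%R, M]%classic : set (measurableTypeR R)).
  exact: measurable_itv.
transitivity (\int[pushforward m c]_x phi x).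
  rewrite (ge0_integral_pushforward mc)//.
rewrite -[`[0%R, M]%classic]setTI -(integral_mrestr lebesgue_measure mD).
apply: eq_measure_integral => A mA _.
(* Open rays form a generating pi-system; on them the two measures are compared according to the
   position of [t] relative to 0 and [M]. *)
pose g n : set (measurableTypeR R) := `]-oo, (n%:R)%R[%classic.
have mG : @measurable _ (measurableTypeR R) = <<s @RGenInftyO.G R >>.
  exact: RGenInftyO.measurableE.
apply: (measure_unique _ g mG) => //=.
- move=> _ _ [x ->] [y ->]; exists (Num.min x y).
  by apply/seteqP; split => z /=; rewrite !in_itv/= lt_min => /andP.
- by move=> n; exists n%:R.
- rewrite -subTset => x _; exists (Num.truncn x).+1 => //=.
  by rewrite /g/= in_itv/= truncnS_gt.
- move=> _ [t ->]; rewrite /pushforward /mrestr.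
  rewrite (_ : c @^-1` _ = [set x | (cmass x < t)%R]); last first.
    by apply/seteqP; split => x /=; rewrite in_itv.
  have [t0|t0] := leP t 0%R.
    rewrite (_ : [set _ | _] = set0) ?measure0; last first.
      rewrite -subset0 => x /=; apply/negP; rewrite -leNgt.
      by rewrite (le_trans t0)// cmass_ge0.
    rewrite (_ : _ `&` _ = set0) ?measure0// -subset0 => x /= [].
    rewrite !in_itv/= => xt /andP[x0 _].
    by move: (lt_le_trans xt t0); rewrite ltNge x0.
  have [tM|tM] := leP t M.
    rewrite m_cmass_lt ?t0//.
    rewrite (_ : _ `&` _ = `[0%R, t[%classic); last first.
      apply/seteqP; split => x /=; rewrite !in_itv/=.
        by move=> [-> /andP[->]].
      by move=> /andP[-> xt]; rewrite xt (le_trans (ltW xt)).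
    by rewrite lebesgue_measure_itv/= lte_fin t0 oppr0 adde0.
  rewrite (_ : [set _ | _] = setT); last first.
    rewrite -subTset => x _ /=; apply: le_lt_trans tM.
    by rewrite /cmass /M fine_le ?m_fin// le_measure ?inE.
  rewrite (_ : _ `&` _ = `[0%R, M]%classic); last first.
    apply/seteqP; split => x /=; rewrite !in_itv/=; first by case.
    by move=> /andP[-> xM]; rewrite xM (le_lt_trans xM).
  have M0 : (0 <= M)%R by rewrite fine_ge0.
  rewrite lebesgue_measure_itv/= lte_fin oppr0 adde0.
  by rewrite -[LHS]fineK ?m_fin// -/M; case: ltgtP M0 => // <-.
- move=> n; rewrite /pushforward (le_lt_trans (le_measure m _ _ (@subsetT _ _)))//.
    by rewrite inE -[X in measurable X]setTI; apply: mc => //; exact: measurable_itv.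
    by rewrite inE.
Qed.

End cumulative_mass.

Section transport.
Context (R : realType) d (T : measurableType d).
Variables (mu : {measure set T -> \bar R}) (D : set T) (X : T -> measurableTypeR R).
Hypotheses (mD : measurable D) (mX : measurable_fun setT X).
Hypothesis D_lty : mu D < +oo.
Hypothesis noatom : forall r, mu (D `&` X @^-1` [set r]) = 0.
Hypothesis X_gt0 : mu (D `&` X @^-1` `]-oo, 0%R]) = 0.
Hypothesis X_le1 : mu (D `&` X @^-1` `]-oo, 1%R]) = mu D.

(** [ge0_integral_cmass] for the image under [X] of [mu] restricted to [D]. Both the whole plane and
    quadrants will serve as [D]. *)
Lemma ge0_integral_cumulative (phi : measurableTypeR R -> \bar R) :
  measurable_fun setT phi -> (forall x, 0 <= phi x) ->
  \int[mu]_(t in D) phi (fine (mu (D `&` X @^-1` `]-oo, (X t)]))) =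
  \int[lebesgue_measure]_(t in `[0%R, fine (mu D)]) phi t.
Proof.
move=> mphi phi0.
pose m' : {measure set _ -> \bar R} := pushforward (mrestr mu mD) X.
pose m := m' mX.
have mE A : m A = mu (D `&` X @^-1` A) by rewrite setIC.
have mT : m setT = mu D by rewrite mE preimage_setT setIT.
rewrite -mT -(@ge0_integral_cmass _ m)//; last 4 first.
- by rewrite mT.
- by move=> r; rewrite mE.
- by rewrite mE.
- by rewrite mE mT.
have mc : measurable_fun setT (cmass m : _ -> measurableTypeR R).
  by apply: measurable_cmass; rewrite mT.
rewrite (ge0_integral_pushforward mX)//; last first.
  exact: (measurableT_comp mphi mc).
rewrite preimage_setT integral_mrestr setTI.
by apply: eq_integral => t _ /=; rewrite /cmass mE.
Qed.

End transport.

(** * Lebesgue measure on the unit interval and on the unit square *)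

Section unit_interval_measure.
Context (R : realType).

Lemma measurable_unit_itv :
  measurable (`[0%R, 1%R]%classic : set (measurableTypeR R)).
Proof. exact: measurable_itv. Qed.

Lemma lebesgue_unit_itv :
  lebesgue_measure (`[0%R, 1%R]%classic : set (measurableTypeR R)) = 1.
Proof. by rewrite lebesgue_measure_itv/= lte_fin ltr01 oppr0 adde0. Qed.

Lemma lebesgue_unit_itv_lty :
  lebesgue_measure (`[0%R, 1%R]%classic : set (measurableTypeR R)) < +oo.
Proof. by rewrite lebesgue_unit_itv ltry. Qed.

(** A measure on the whole line, so that Tonelli's theorem and the transforms can be used over
    [setT]; [lebesgue_squareE] links its square to [lebesgue_square]. *)
Definition leb01 : {sigma_finite_measure set (measurableTypeR R) -> \bar R} :=
  mfrestr measurable_unit_itv lebesgue_unit_itv_lty.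

Lemma leb01E A : leb01 A = lebesgue_measure (A `&` `[0%R, 1%R]%classic).
Proof. by []. Qed.

Lemma integral_leb01 (A : set (measurableTypeR R)) (f : _ -> \bar R) :
  \int[leb01]_(x in A) f x =
  \int[lebesgue_measure]_(x in A `&` `[0%R, 1%R]%classic) f x.
Proof. exact: (integral_mrestr lebesgue_measure measurable_unit_itv). Qed.

Lemma integralT_leb01 (f : measurableTypeR R -> \bar R) :
  \int[leb01]_x f x = \int[lebesgue_measure]_(x in `[0%R, 1%R]) f x.
Proof. by rewrite integral_leb01 setTI. Qed.

Lemma leb01T : leb01 setT = 1.
Proof. by rewrite leb01E setTI lebesgue_unit_itv. Qed.

Lemma leb01_set1 r : leb01 [set r] = 0.
Proof.
rewrite leb01E; apply/eqP; rewrite -measure_le0;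
apply: (@le_trans _ _ (lebesgue_measure [set r])).
  by apply: measureIl; [exact: measurable_set1|exact: measurable_itv].
by rewrite lebesgue_measure_set1.
Qed.

Lemma leb01_le0 : leb01 `]-oo, 0%R]%classic = 0.
Proof.
rewrite leb01E (_ : _ `&` _ = [set 0%R]) ?lebesgue_measure_set1//.
apply/seteqP; split => x /=; rewrite !in_itv/=.
  by move=> [x0 /andP[x1 _]]; apply/eqP; rewrite eq_le x0.
by move=> ->; rewrite lexx ler01.
Qed.

Lemma leb01_itvNy y : (0 <= y <= 1)%R -> leb01 `]-oo, y]%classic = y%:E.
Proof.
move=> /andP[y0 y1]; rewrite leb01E (_ : _ `&` _ = `[0%R, y]%classic); last first.
  apply/seteqP; split => x /=; rewrite !in_itv/=.
    by move=> [-> /andP[->]].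
  by move=> /andP[-> xy]; rewrite xy (le_trans xy).
rewrite lebesgue_measure_itv/= lte_fin oppr0 adde0.
by case: ltgtP y0 => // <-.
Qed.

Lemma leb01_gt1 : leb01 `]1%R, +oo[%classic = 0.
Proof.
rewrite leb01E (_ : _ `&` _ = set0) ?measure0// -subset0 => x /=.
by rewrite !in_itv/= andbT => -[x0 /andP[_]]; rewrite leNgt x0.
Qed.

Definition leb01_sq : {measure set (plane R) -> \bar R} :=
  leb01 \x leb01.

Lemma lebesgue_squareE (A : set (plane R)) : measurable A ->
  lebesgue_square R A = leb01_sq A.
Proof.
move=> mA; apply/esym/product_measure_unique => // X Y mX mY.
rewrite /= /mfrestr /mrestr -setXI/=.
by rewrite product_measure1E//; exact: measurableI.
Qed.

Lemma integral_lebesgue_square (A : set (plane R)) (f : _ -> \bar R) :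
  \int[lebesgue_square R]_(z in A) f z = \int[leb01_sq]_(z in A) f z.
Proof. by apply: eq_measure_integral => B mB _; exact: lebesgue_squareE. Qed.

Lemma leb01_sq_fst (A : set (measurableTypeR R)) : measurable A ->
  leb01_sq (fst @^-1` A) = leb01 A.
Proof.
move=> mA; rewrite (_ : _ @^-1` _ = A `*` setT); last first.
  by apply/seteqP; split => z //= -[].
transitivity (leb01 A * leb01 setT); first exact: product_measure1E.
by rewrite leb01T mule1.
Qed.

Lemma leb01_sq_snd (A : set (measurableTypeR R)) : measurable A ->
  leb01_sq (snd @^-1` A) = leb01 A.
Proof.
move=> mA; rewrite (_ : _ @^-1` _ = setT `*` A); last first.
  by apply/seteqP; split => z //= -[].
transitivity (leb01 setT * leb01 A); first exact: product_measure1E.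
by rewrite leb01T mul1e.
Qed.

Lemma unit_squareE : unit_square R =
  (fst @^-1` `[0%R, 1%R]) `&` (snd @^-1` `[0%R, 1%R]).
Proof. by []. Qed.

(* A probability density on [0,1] evaluated through its own distribution
   function is uniform. *)
Lemma ge0_integral_distribution (f : measurableTypeR R -> R)
    (phi : measurableTypeR R -> \bar R) :
  measurable_fun setT f -> (forall x, 0 <= f x)%R ->
  \int[leb01]_x (f x)%:E = 1 ->
  measurable_fun setT phi -> (forall x, 0 <= phi x) ->
  \int[leb01]_x (phi (fine (\int[leb01]_(t in `]-oo, x]) (f t)%:E)) * (f x)%:E) =
  \int[leb01]_x phi x.
Proof.
move=> mf f0 f1 mphi phi0.
have mfE : measurable_fun setT (EFin \o f) by exact/measurable_EFinP.
have f0E x : 0 <= (EFin \o f) x by rewrite lee_fin.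
pose m : {measure set (measurableTypeR R) -> \bar R} := mdensity leb01 mfE f0E.
have mT : m setT = 1 := f1.
have mnull A : measurable A -> leb01 A = 0 -> m A = 0.
  move=> mA A0; apply: null_set_integral => //; exact: measurable_funTS.
have mray r : m `]-oo, r]%classic = \int[leb01]_(t in `]-oo, r]) (f t)%:E by [].
under eq_integral do rewrite -mray.
rewrite -(@ge0_integral_density _ _ _ leb01 m f mf f0 _ setT
  (fun x => phi (cmass m x)))//; last first.
  apply: measurableT_comp => //; apply: measurable_cmass.
  by rewrite mT ltry.
rewrite ge0_integral_cmass//.
- by rewrite mT integralT_leb01.
- by rewrite mT ltry.
- by move=> r; apply: mnull; [exact: measurable_set1|exact: leb01_set1].
- by apply: mnull; [exact: measurable_itv|exact: leb01_le0].
- rewrite -[`]-oo, _]%classic]setTI measureI_conull//.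
  rewrite setCitvl; apply: mnull; [exact: measurable_itv|exact: leb01_gt1].
Qed.

End unit_interval_measure.

(** * Distribution functions on the square *)

Section distribution_functions.
Context (R : realType).
Implicit Types (nu : probability (plane R) R) (u : plane R -> R).
Local Notation RR := (measurableTypeR R).
Local Notation leb01 := (leb01 R).
Local Notation leb01_sq := (leb01_sq R).

(** [cumul], [marg1], [slice_mass] and [slice_total] are the F, A, g and m of the overview. [fine]
    would turn an infinite slice integral into 0; the hypothesis [ufin] below excludes that. *)
Definition cumul nu (x y : R) : R := fine (nu (`]-oo, x] `*` `]-oo, y])).

Definition marg1 nu (x : R) : R := fine (nu (fst @^-1` `]-oo, x])).

Definition slice_mass u (x y : R) : R :=
  fine (\int[leb01]_(t in `]-oo, x]) (u (t, y))%:E).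

Definition slice_total u (y : R) : R := fine (\int[leb01]_t (u (t, y))%:E).

Lemma measurable_ray (x : R) : measurable (`]-oo, x]%classic : set RR).
Proof. exact: measurable_itv. Qed.

Lemma measurable_fst_ray (x : R) :
  measurable (fst @^-1` `]-oo, x] : set (plane R)).
Proof.
by rewrite -[X in measurable X]setTI; apply: measurable_fst => //; exact: measurable_ray.
Qed.

Lemma measurable_snd_ray (y : R) :
  measurable (snd @^-1` `]-oo, y] : set (plane R)).
Proof.
by rewrite -[X in measurable X]setTI; apply: measurable_snd => //; exact: measurable_ray.
Qed.

Lemma measurable_quadrant (x y : R) :
  measurable (`]-oo, x] `*` `]-oo, y] : set (plane R)).
Proof. by apply: measurableX; exact: measurable_ray. Qed.

Lemma cumulE nu x y : (cumul nu x y)%:E = nu (`]-oo, x] `*` `]-oo, y]).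
Proof. by rewrite fineK// fin_num_measure//; exact: measurable_quadrant. Qed.

Lemma marg1E nu x : (marg1 nu x)%:E = nu (fst @^-1` `]-oo, x]).
Proof. by rewrite fineK// fin_num_measure//; exact: measurable_fst_ray. Qed.

Lemma cumul_ge0 nu x y : (0 <= cumul nu x y)%R.
Proof. by rewrite fine_ge0. Qed.

Lemma marg1_ge0 nu x : (0 <= marg1 nu x)%R.
Proof. by rewrite fine_ge0. Qed.

Lemma marg1_le1 nu x : (marg1 nu x <= 1)%R.
Proof. by rewrite -lee_fin marg1E probability_le1//; exact: measurable_fst_ray. Qed.

Lemma marg1_nd nu : {homo marg1 nu : x y / (x <= y)%R}.
Proof.
move=> x y xy; rewrite -lee_fin !marg1E le_measure ?inE//; try exact: measurable_fst_ray.
by apply: preimage_subset; exact: subset_itvl.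
Qed.

Lemma measurable_marg1 nu : measurable_fun setT (marg1 nu : RR -> R).
Proof. exact: nondecreasing_measurable (@marg1_nd nu). Qed.

Let below1 : set (plane R * RR) := [set p | (p.2 <= p.1.1)%R].

Let mbelow1 : measurable below1.
Proof.
rewrite -[X in measurable X]setTI; apply: measurable_fun_le => //.
by apply: measurableT_comp => //; exact: measurable_fst.
Qed.

(** The quadrant at [z] is the section at [z] of a single measurable set [S] of pairs of points, and
    the measure of a section is a measurable function. *)
Lemma measurable_cumul nu :
  measurable_fun setT (fun z : plane R => cumul nu z.1 z.2).
Proof.
pose S : set (plane R * plane R) :=
  [set p | (p.2.1 <= p.1.1)%R] `&` [set p | (p.2.2 <= p.1.2)%R].
have m1 i j : measurable_fun setT
    (fun p : plane R * plane R => (if j then fst else snd) (if i then p.1 else p.2)).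
  apply: measurableT_comp; first by case: j; [exact: measurable_fst|exact: measurable_snd].
  by case: i; [exact: measurable_fst|exact: measurable_snd].
have mS : measurable S.
  apply: measurableI.
    rewrite -[X in measurable X]setTI; apply: measurable_fun_le => //.
      exact: (m1 false true).
    exact: (m1 true true).
  rewrite -[X in measurable X]setTI; apply: measurable_fun_le => //.
    exact: (m1 false false).
  exact: (m1 true false).
apply: measurableT_comp => //.
rewrite (_ : (fun _ => _) = nu \o xsection S); first exact: measurable_fun_xsection.
apply/funext => z /=; congr (nu _); apply/seteqP; split => q /=.
  by rewrite /xsection/= !in_itv/= => -[? ?]; rewrite inE.
by rewrite /xsection/= !in_itv/= inE.
Qed.

Section slices.
Variable u : plane R -> R.
Hypotheses (mu : measurable_fun setT u) (u0 : forall z, (0 <= u z)%R).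

Lemma measurable_slice (y : R) : measurable_fun setT (fun x : RR => u (x, y)).
Proof. by apply: measurableT_comp => //; exact: measurable_pair2. Qed.

Lemma slice_mass_ge0 x y : (0 <= slice_mass u x y)%R.
Proof. by rewrite fine_ge0// integral_ge0// => t _; rewrite lee_fin. Qed.

Lemma slice_total_ge0 y : (0 <= slice_total u y)%R.
Proof. by rewrite fine_ge0// integral_ge0// => t _; rewrite lee_fin. Qed.

(** The ray of integration varies with [z], so its indicator [below1] is moved into the integrand;
    Tonelli's theorem then gives measurability in [z]. *)
Lemma measurable_slice_mass :
  measurable_fun setT (fun z : plane R => slice_mass u z.1 z.2).
Proof.
apply: measurableT_comp => //.
pose f (p : plane R * RR) := ((\1_below1 p : R) * u (p.2, p.1.2))%:E.
have mf : measurable_fun setT f.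
  apply/measurable_EFinP; apply: measurable_funM; first exact: measurable_indic.
  apply: measurableT_comp => //; apply: measurable_fun_pair.
    exact: measurable_snd.
  by apply: measurableT_comp; [exact: measurable_snd|exact: measurable_fst].
have f0 p : 0 <= f p by rewrite lee_fin mulr_ge0.
have := measurable_fun_fubini_tonelli_F (m2 := leb01) f mf f0.
congr (measurable_fun _ _); apply/funext => z.
rewrite /fubini_F [RHS]integral_mkcond; apply: eq_integral => t _.
rewrite patchE /f indicE.
rewrite (_ : (t \in `]-oo, z.1]%classic) = (t <= z.1)%R); last first.
  by apply/idP/idP; rewrite inE/= in_itv.
rewrite (_ : ((z, t) \in _) = (t <= z.1)%R); last first.
  by apply/idP/idP; rewrite inE.
by case: ifP; rewrite ?mul1r ?mul0r.
Qed.

Lemma measurable_slice_total : measurable_fun setT (slice_total u : RR -> R).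
Proof.
apply: measurableT_comp => //.
apply: (measurable_fun_fubini_tonelli_G (m1 := leb01) (EFin \o u)).
  exact/measurable_EFinP.
by move=> x; rewrite lee_fin.
Qed.

End slices.

End distribution_functions.

Section uniform_transforms.
Context (R : realType).
Variables (nu : probability (plane R) R) (u : plane R -> R).
Local Notation RR := (measurableTypeR R).
Local Notation leb01 := (leb01 R).
Local Notation leb01_sq := (leb01_sq R).
Hypotheses (mu : measurable_fun setT u) (u0 : forall z, (0 <= u z)%R).
Hypothesis ufin : forall y, \int[leb01]_x (u (x, y))%:E < +oo.
Hypothesis nuE : forall A, measurable A ->
  nu A = \int[leb01_sq]_(z in A) (u z)%:E.

Lemma density_null A : measurable A -> leb01_sq A = 0 -> nu A = 0.
Proof.
move=> mA A0; rewrite nuE//; apply: null_set_integral => //.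
by apply/measurable_EFinP; exact: measurable_funTS.
Qed.

Lemma density_null_fst (A : set RR) : measurable A -> leb01 A = 0 ->
  nu (fst @^-1` A) = 0.
Proof.
move=> mA A0; apply: density_null; last by rewrite leb01_sq_fst.
by rewrite -[X in measurable X]setTI; exact: measurable_fst.
Qed.

Lemma density_null_snd (A : set RR) : measurable A -> leb01 A = 0 ->
  nu (snd @^-1` A) = 0.
Proof.
move=> mA A0; apply: density_null; last by rewrite leb01_sq_snd.
by rewrite -[X in measurable X]setTI; exact: measurable_snd.
Qed.

Lemma ge0_integral_density2 (D : set (plane R)) (f : plane R -> \bar R) :
  measurable D -> measurable_fun D f -> (forall z, D z -> 0 <= f z) ->
  \int[nu]_(z in D) f z = \int[leb01_sq]_(z in D) (f z * (u z)%:E).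
Proof. exact: (ge0_integral_density mu u0 nuE). Qed.

(** Under [nu] the first coordinate has distribution function [marg1 nu], and no atoms because [nu]
    has a density. *)
Lemma integral_marg1 (phi : RR -> \bar R) :
  measurable_fun setT phi -> (forall x, 0 <= phi x) ->
  \int[nu]_z phi (marg1 nu z.1) = \int[leb01]_x phi x.
Proof.
move=> mphi phi0; rewrite integralT_leb01.
transitivity (\int[lebesgue_measure]_(t in `[0%R, fine (nu setT)]) phi t);
  last by rewrite probability_setT.
rewrite -(@ge0_integral_cumulative R _ _ nu _ fst measurableT measurable_fst)//.
- by apply: eq_integral => z _; rewrite setTI.
- by rewrite -ge0_fin_numE// fin_num_measure.
- move=> r; rewrite setTI; apply: density_null_fst; first exact: measurable_set1.
  exact: leb01_set1.
- by rewrite setTI; apply: density_null_fst; [exact: measurable_ray|exact: leb01_le0].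
- rewrite measureI_conull//; first exact: measurable_fst_ray.
  rewrite preimage_setC setCitvl; apply: density_null_fst; first exact: measurable_itv.
  exact: leb01_gt1.
Qed.

(** With [x] fixed, s |-> F(x, s) is the mass function of the second coordinate under [nu]
    restricted to abscissas at most [x], so the transform applies on the quadrant. *)
Lemma integral_cumul (x y : R) (phi : RR -> \bar R) :
  measurable_fun setT phi -> (forall x, 0 <= phi x) ->
  \int[nu]_(z in `]-oo, x] `*` `]-oo, y]) phi (cumul nu x z.2) =
  \int[lebesgue_measure]_(t in `[0%R, cumul nu x y]) phi t.
Proof.
move=> mphi phi0.
have mQ := measurable_quadrant x y.
rewrite -(@ge0_integral_cumulative R _ _ nu _ snd mQ measurable_snd)//.
- apply: eq_integral => z; rewrite inE => -[/= zx]; rewrite in_itv/= => zy.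
  congr (phi (fine (nu _))); apply/seteqP; split => t /=; rewrite !in_itv/=.
    by move=> [-> tz]; split => //; split => //; exact: le_trans tz zy.
  by move=> [[-> _] ->].
- by rewrite -ge0_fin_numE// fin_num_measure.
- move=> r; have m1 : measurable (snd @^-1` [set r] : set (plane R)).
    by rewrite -[X in measurable X]setTI; exact: measurable_snd.
  apply: (subset_measure0 _ _ (@subIsetr _ _ _)) => //; first exact: measurableI.
  exact: density_null_snd (leb01_set1 r).
- have m0 := measurable_snd_ray (0%R : R).
  apply: (subset_measure0 _ _ (@subIsetr _ _ _)) => //; first exact: measurableI.
  exact: density_null_snd (measurable_ray _) (leb01_le0 R).
- rewrite measureI_conull//; first exact: measurable_snd_ray.
  rewrite preimage_setC setCitvl; apply: density_null_snd; first exact: measurable_itv.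
  exact: leb01_gt1.
Qed.

Lemma slice_totalE y : (slice_total u y)%:E = \int[leb01]_x (u (x, y))%:E.
Proof.
by rewrite fineK// ge0_fin_numE ?ufin// integral_ge0// => x _; rewrite lee_fin.
Qed.

Lemma slice_massE x y :
  (slice_mass u x y)%:E = \int[leb01]_(t in `]-oo, x]) (u (t, y))%:E.
Proof.
have u0E t : 0 <= (u (t, y))%:E by rewrite lee_fin.
rewrite fineK// ge0_fin_numE ?integral_ge0// (le_lt_trans _ (ufin y))//.
apply: ge0_subset_integral => //.
by apply/measurable_EFinP; exact: measurable_slice.
Qed.

Lemma integral_slice_total : \int[leb01]_y (slice_total u y)%:E = 1.
Proof.
rewrite -(probability_setT nu) nuE//.
transitivity (\int[leb01]_y \int[leb01]_x (u (x, y))%:E).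
  by apply: eq_integral => y _; rewrite slice_totalE.
rewrite [RHS](fubini_tonelli2 (EFin \o u))//.
  exact/measurable_EFinP.
Qed.

(** Given the ordinate y, the abscissa has density u(., y) / m(y), whose distribution function is
    g(., y) / m(y). The ratio is thus uniform on each slice by [ge0_integral_distribution], and the
    weights m(y) have total mass 1. *)
Lemma integral_slice (phi : RR -> \bar R) :
  measurable_fun setT phi -> (forall x, 0 <= phi x) ->
  \int[nu]_z phi (slice_mass u z.1 z.2 / slice_total u z.2)%R = \int[leb01]_x phi x.
Proof.
move=> mphi phi0.
have minv : measurable_fun setT (fun z : plane R => (slice_total u z.2)^-1)%R.
  apply: (measurableT_comp (@measurable_invr R)).
  exact: measurableT_comp (measurable_slice_total mu u0) measurable_snd.
have mratio : measurable_fun setT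
    (fun z : plane R => (slice_mass u z.1 z.2 / slice_total u z.2)%R : RR).
  by apply: measurable_funM => //; exact: measurable_slice_mass.
have mphir := measurableT_comp mphi mratio.
rewrite ge0_integral_density2//.
pose f (z : plane R) := phi (slice_mass u z.1 z.2 / slice_total u z.2)%R * (u z)%:E.
rewrite [LHS](fubini_tonelli2 f); last 2 first.
  by apply: emeasurable_funM => //; exact/measurable_EFinP.
  by move=> z; rewrite /f mule_ge0 ?lee_fin.
rewrite /fubini_G.
transitivity (\int[leb01]_y ((\int[leb01]_x phi x) * (slice_total u y)%:E)); last first.
  rewrite ge0_integralZl//.
  - by rewrite integral_slice_total mule1.
  - apply/measurable_EFinP; exact: measurable_slice_total.
  - by move=> y _; rewrite lee_fin slice_total_ge0.
  - by rewrite integral_ge0.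
apply: eq_integral => y _; rewrite /f /=.
(* On a slice of mass 0 the ratio is 0 since [0^-1 = 0], and both sides vanish. *)
have [m0|m0] := eqVneq (slice_total u y) 0%R.
  rewrite m0 mule0 (_ : (fun _ => _) = fun x => phi 0%R * (u (x, y))%:E); last first.
    by apply/funext => x; rewrite invr0 mulr0.
  have uy0 : \int[leb01]_x (u (x, y))%:E = 0 by rewrite -slice_totalE m0.
  rewrite ge0_integralZl ?uy0 ?mule0//.
  - by apply/measurable_EFinP; exact: measurable_slice.
  - by move=> x _; rewrite lee_fin.
have m_gt0 : (0 < slice_total u y)%R by rewrite lt_def m0 slice_total_ge0.
pose m := slice_total u y.
pose g x := (u (x, y) / m)%R.
have mg : measurable_fun setT (g : RR -> R).
  by apply: measurable_funM => //; exact: measurable_slice.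
have u0E t : 0 <= (u (t, y))%:E by rewrite lee_fin.
have gint D : measurable D -> \int[leb01]_(x in D) (g x)%:E =
    (m^-1)%:E * \int[leb01]_(x in D) (u (x, y))%:E.
  move=> mD; rewrite -ge0_integralZl_EFin//.
  - by apply: eq_integral => x _; rewrite /g mulrC EFinM.
  - apply/measurable_EFinP; apply: measurable_funTS; exact: measurable_slice.
  - by rewrite invr_ge0 ltW.
rewrite -(@ge0_integral_distribution R g phi)//; last 2 first.
- by move=> x; rewrite divr_ge0// ltW.
- by rewrite gint// -slice_totalE -EFinM mulVf.
rewrite -ge0_integralZr//; last 3 first.
- apply: emeasurable_funM; last exact/measurable_EFinP.
  apply: measurableT_comp => //; rewrite (_ : (fun _ => _) =
      fun x => slice_mass u x y / m)%R; last first.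
    apply/funext => x; rewrite gint; last exact: measurable_ray.
    by rewrite -slice_massE -EFinM/= mulrC.
  apply: measurable_funM => //.
  exact: measurableT_comp (measurable_slice_mass mu u0) (measurable_pair2 _).
- by move=> x _; rewrite mule_ge0// lee_fin divr_ge0// ltW.
- by rewrite lee_fin ltW.
apply: eq_integral => x _; rewrite gint; last exact: measurable_ray.
rewrite -slice_massE -EFinM/= -muleA -EFinM divfK//.
by rewrite mulrC.
Qed.

End uniform_transforms.

(** * The conditional density *)

Section exponential_integral.
Context (R : realType).
Implicit Types beta t a x : R.

(** The integral of [expR (- (beta * s))] over [0, t], hence positive for [t > 0] whatever the sign
    of [beta]. At t = A(x) it is the Z of the overview. *)
Definition expint beta t : R := ((1 - expR (- (beta * t))) / beta)%R.

Lemma expint_gt0 beta t : beta != 0%R -> (0 < t)%R -> (0 < expint beta t)%R.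
Proof.
move=> b0 t0; rewrite /expint.
have [bn|bp|/eqP] := ltgtP beta 0%R; last by rewrite (negbTE b0).
  rewrite nmulr_rgt0 ?invr_lt0// subr_lt0 -[ltLHS]expR0 ltr_expR oppr_gt0.
  by rewrite nmulr_rlt0.
by rewrite divr_gt0// subr_gt0 -[ltRHS]expR0 ltr_expR oppr_lt0 mulr_gt0.
Qed.

Lemma expint0 beta : expint beta 0 = 0%R.
Proof. by rewrite /expint mulr0 oppr0 expR0 subrr mul0r. Qed.

Lemma expint_ge0 beta t : beta != 0%R -> (0 <= t)%R -> (0 <= expint beta t)%R.
Proof.
move=> b0; rewrite le_eqVlt => /predU1P[<-|t0]; first by rewrite expint0.
by rewrite ltW// expint_gt0.
Qed.

Lemma is_derive_expRM beta x :
  is_derive x 1%R (fun t => expR (beta * t)) (beta * expR (beta * x))%R.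
Proof.
have H1 : is_derive x 1%R (fun t => beta * t)%R beta.
  have := is_deriveZ beta (is_derive_id x 1%R).
  by rewrite /GRing.scale /= mulr1.
have := is_derive1_comp (is_derive_expR (beta * x)%R) H1.
by rewrite mulrC.
Qed.

Lemma integral_expR beta a : beta != 0%R -> (0 <= a)%R ->
  \int[lebesgue_measure]_(t in `[0%R, a]) (expR (beta * t))%:E =
  ((expR (beta * a) - 1) / beta)%:E.
Proof.
move=> b0; rewrite le_eqVlt => /predU1P[<-|a0].
  by rewrite set_itv1 integral_set1 mulr0 expR0 subrr mul0r.
pose F t := (expR (beta * t) / beta)%R.
have dF x : is_derive x 1%R F (expR (beta * x))%R.
  have := is_deriveZ (beta^-1)%R (is_derive_expRM beta x).
  rewrite [X in is_derive _ _ _ X]/GRing.scale/= mulrA mulVf// mul1r.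
  suff -> : F = (beta^-1 \*: (fun t => expR (beta * t)))%R by [].
  by apply/funext => t; rewrite /F /= mulrC.
have cexp : continuous (fun t => expR (beta * t)).
  move=> x; apply/differentiable_continuous/derivable1_diffP.
  by have [] := is_derive_expRM beta x.
have cF : continuous F.
  by move=> x; apply/differentiable_continuous/derivable1_diffP; have [] := dF x.
rewrite (@continuous_FTC2 R (fun t => expR (beta * t)) F)//.
- by rewrite -EFinB /F mulr0 expR0 -mulrBl.
- exact: continuous_subspaceT.
- split.
  + by move=> x _; have [] := dF x.
  + by apply: cvg_at_right_filter; exact: cF.
  + by apply: cvg_at_left_filter; exact: cF.
- by move=> x _; rewrite derive1E; have [_ ->] := dF x.
Qed.

End exponential_integral.

Section next_point_density.
Context (R : realType).
Local Notation RR := (measurableTypeR R).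
Local Notation leb01 := (leb01 R).
Local Notation leb01_sq := (leb01_sq R).
Variables (beta : R) (nu : probability (plane R) R) (u : plane R -> R).
Hypothesis b0 : beta != 0%R.

(** The part of w that depends on [x] only. It is 0 where [marg1 nu x] is 0, since [expint beta 0]
    is 0. *)
Definition cond_factor x : R :=
  (expR (- (beta * marg1 nu x)) / expint beta (marg1 nu x))%R.

Definition cond_density (z : plane R) : R :=
  (cond_factor z.1 * (slice_mass u z.1 z.2 * expR (beta * cumul nu z.1 z.2)))%R.

Lemma cond_factor_ge0 x : (0 <= cond_factor x)%R.
Proof. by rewrite divr_ge0 ?expR_ge0// expint_ge0// marg1_ge0. Qed.

Lemma measurable_expint : measurable_fun setT (expint beta : R -> R).
Proof.
apply: measurable_funM => //; apply: measurable_funB => //.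
by apply: measurableT_comp => //; apply: measurableT_comp.
Qed.

Lemma measurable_cond_factor : measurable_fun setT (cond_factor : RR -> R).
Proof.
have mA := measurable_marg1 nu.
apply: measurable_funM.
  apply: measurableT_comp => //; apply: measurableT_comp => //.
  exact: measurable_funM.
apply: (measurableT_comp (@measurable_invr R)).
exact: measurableT_comp measurable_expint mA.
Qed.

Hypotheses (mu : measurable_fun setT u) (u0 : forall z, (0 <= u z)%R).

Lemma cond_density_ge0 z : (0 <= cond_density z)%R.
Proof.
rewrite /cond_density mulr_ge0 ?cond_factor_ge0// mulr_ge0 ?expR_ge0//.
by rewrite slice_mass_ge0.
Qed.

Lemma measurable_cond_density : measurable_fun setT cond_density.
Proof.
apply: measurable_funM.
  exact: measurableT_comp measurable_cond_factor measurable_fst.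
apply: measurable_funM; first by apply: measurable_slice_mass.
apply: measurableT_comp => //; apply: measurable_funM => //.
exact: measurable_cumul.
Qed.

Hypothesis ufin : forall y, \int[leb01]_x (u (x, y))%:E < +oo.
Hypothesis nuE : forall A, measurable A ->
  nu A = \int[leb01_sq]_(z in A) (u z)%:E.

(** Formally the substitution t = F(x, s), dt = g(x, s) ds. Tonelli's theorem turns the left side
    into the integral of e^(beta F(x, .)) over the quadrant against [nu], and [integral_cumul]
    evaluates it without differentiating F. *)
Lemma integral_slice_mass_exp (x y : R) :
  \int[leb01]_(s in `]-oo, y]) (slice_mass u x s * expR (beta * cumul nu x s))%:E =
  ((expR (beta * cumul nu x y) - 1) / beta)%:E.
Proof.
rewrite -integral_expR ?cumul_ge0//.
pose phi (t : RR) := (expR (beta * t))%:E.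
have mphi : measurable_fun setT phi.
  apply/measurable_EFinP; apply: measurableT_comp => //; exact: measurable_funM.
rewrite -(integral_cumul mu nuE _ _ mphi); last by move=> t; rewrite lee_fin expR_ge0.
have mQ := measurable_quadrant x y.
have mphic : measurable_fun setT (fun z : plane R => phi (cumul nu x z.2)).
  apply: measurableT_comp => //.
  have := measurableT_comp (measurable_cumul nu)
    (measurableT_comp (measurable_pair1 x) (@measurable_snd _ _ RR RR)).
  exact.
rewrite (ge0_integral_density2 mu u0 nuE)//; last 2 first.
  exact: measurable_funTS.
  by move=> z _; rewrite lee_fin expR_ge0.
rewrite [RHS]integral_mkcond.
set f := (X in _ = integral _ _ X).
rewrite [RHS](fubini_tonelli2 f); last 2 first.
- apply/(measurable_restrictT _ mQ); apply: measurable_funTS.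
  by apply: emeasurable_funM => //; exact/measurable_EFinP.
- move=> z; apply: erestrict_ge0 => t _.
  by rewrite mule_ge0 ?lee_fin ?expR_ge0.
rewrite [LHS]integral_mkcond; apply: eq_integral => s _.
rewrite /fubini_G /f patchE; case: ifPn => sy; last first.
  rewrite integral0_eq// => t _; rewrite patchE ifF//.
  by apply/negP; rewrite inE => -[_ /= /mem_set]; apply/negP.
transitivity (\int[leb01]_(t in `]-oo, x]) ((u (t, s))%:E * phi (cumul nu x s))).
  rewrite ge0_integralZr//.
  - by rewrite -slice_massE//.
  - apply/measurable_EFinP; apply: measurable_funTS; exact: measurable_slice.
  - by move=> t _; rewrite lee_fin.
  - by rewrite lee_fin expR_ge0.
rewrite [LHS]integral_mkcond; apply: eq_integral => t _; rewrite !patchE.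
rewrite (_ : ((t, s) \in _) = (t \in `]-oo, x]%classic)); last first.
  apply/idP/idP; rewrite !inE; first by case.
  by move=> tx; split => //; move: sy; rewrite inE.
by case: ifP => // _; rewrite muleC.
Qed.

Lemma integral_cond_density (B : set RR) (y : R) : measurable B ->
  \int[leb01_sq]_(z in B `*` `]-oo, y]) (cond_density z)%:E =
  \int[leb01]_(x in B)
    (cond_factor x * ((expR (beta * cumul nu x y) - 1) / beta))%:E.
Proof.
move=> mB; have mR := measurable_ray y.
have mBR : measurable (B `*` `]-oo, y] : set (plane R)) by exact: measurableX.
rewrite integral_mkcond [RHS]integral_mkcond.
set f := (X in integral _ _ X).
rewrite [LHS](fubini_tonelli1 f); last 2 first.
- apply/(measurable_restrictT _ mBR); apply: measurable_funTS.
  by apply/measurable_EFinP; exact: measurable_cond_density.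
- by move=> z; apply: erestrict_ge0 => t _; rewrite lee_fin cond_density_ge0.
apply: eq_integral => x _; rewrite /fubini_F /f [RHS]patchE.
case: ifPn => xB; last first.
  rewrite integral0_eq// => t _; rewrite patchE ifF//.
  by apply/negP; rewrite inE => -[/= /mem_set + _]; apply/negP.
rewrite EFinM -[X in _ * X]integral_slice_mass_exp -ge0_integralZl//; last 3 first.
- apply/measurable_EFinP; apply: measurable_funTS; apply: measurable_funM.
    exact: measurableT_comp (measurable_slice_mass mu u0) (measurable_pair1 _).
  apply: measurableT_comp => //; apply: measurable_funM => //.
  exact: measurableT_comp (measurable_cumul _) (measurable_pair1 _).
- by move=> s _; rewrite lee_fin mulr_ge0 ?expR_ge0 ?slice_mass_ge0.
- by rewrite lee_fin cond_factor_ge0.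
rewrite [RHS]integral_mkcond; apply: eq_integral => s _; rewrite !patchE.
rewrite (_ : ((x, s) \in _) = (s \in `]-oo, y]%classic)); last first.
  apply/idP/idP; rewrite !inE; first by case.
  by move=> sy; split => //; move: xB; rewrite inE.
by case: ifP.
Qed.

Lemma cumul1 x : cumul nu x 1 = marg1 nu x.
Proof.
rewrite /cumul /marg1; congr fine.
rewrite (_ : _ `*` _ = (fst @^-1` `]-oo, x]) `&` (snd @^-1` `]-oo, 1%R]))//.
rewrite measureI_conull//.
- exact: measurable_snd_ray.
- exact: measurable_fst_ray.
rewrite preimage_setC setCitvl.
apply: (density_null_snd mu nuE); [exact: measurable_itv|exact: leb01_gt1].
Qed.

(** The normalization of w: (e^(beta A) - 1) / beta is e^(beta A) Z, which the factor e^(-beta A) /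
    Z cancels unless A = 0. *)
Lemma cond_factorM x :
  (cond_factor x * ((expR (beta * marg1 nu x) - 1) / beta) =
   (marg1 nu x != 0)%:R)%R.
Proof.
have [A0|A0] := eqVneq (marg1 nu x) 0%R.
  by rewrite /cond_factor A0 expint0 invr0 mulr0 mul0r.
have A_gt0 : (0 < marg1 nu x)%R by rewrite lt_def A0 marg1_ge0.
have Z0 := expint_gt0 b0 A_gt0.
have -> : ((expR (beta * marg1 nu x) - 1) / beta =
    expR (beta * marg1 nu x) * expint beta (marg1 nu x))%R.
  by rewrite /expint mulrA mulrBr mulr1 -expRD subrr expR0.
by rewrite /cond_factor mulrACA -expRD addNr expR0 mul1r mulVf// gt_eqF.
Qed.

(** The column over [x] has w-mass 1 if [marg1 nu x] is nonzero and 0 otherwise, hence an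
    inequality. *)
Lemma cond_density_mass (B : set RR) : measurable B ->
  \int[leb01_sq]_(z in fst @^-1` B) (cond_density z)%:E <= leb01 B.
Proof.
move=> mB; have mR := measurable_ray (1%R : R).
have mBR : measurable (B `*` `]-oo, 1%R] : set (plane R)) by exact: measurableX.
have mB1 : measurable (fst @^-1` B : set (plane R)).
  by rewrite -[X in measurable X]setTI; exact: measurable_fst.
have w0 z : 0 <= (cond_density z)%:E by rewrite lee_fin cond_density_ge0.
have mwE := measurable_cond_density.
have mN : measurable (snd @^-1` `]1%R, +oo[ : set (plane R)).
  rewrite -[X in measurable X]setTI; exact: measurable_snd.
(* Ordinates above 1 are negligible, so the strip can be cut at height 1, where [cumul] equals
   [marg1]. *)
rewrite (ge0_negligible_integral mN)//; last 2 first.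
- by apply/measurable_EFinP; apply: measurable_funTS.
- by rewrite leb01_sq_snd ?leb01_gt1//; exact: measurable_itv.
rewrite (_ : _ `\` _ = B `*` `]-oo, 1%R]); last first.
  by rewrite setDE preimage_setC setCitvr.
rewrite integral_cond_density// -[leRHS]mul1e -integral_cst//.
apply: ge0_le_integral => //.
- by move=> x _; rewrite cumul1 cond_factorM lee_fin.
- apply/measurable_EFinP; apply: measurable_funTS.
  under eq_fun do rewrite cumul1.
  apply: measurable_funM; first exact: measurable_cond_factor.
  apply: measurable_funM => //; apply: measurable_funB => //.
  apply: measurableT_comp => //; apply: measurable_funM => //.
  exact: measurable_marg1.
- by move=> x _; rewrite cumul1 cond_factorM lee_fin; case: (_ != _).
Qed.

End next_point_density.

(** * The energy as a single integral *)

Section energy_formula.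
Context (R : realType).
Local Notation RR := (measurableTypeR R).
Local Notation leb01 := (leb01 R).
Local Notation leb01_sq := (leb01_sq R).
Variables (nu : probability (plane R) R) (u : plane R -> R).
Hypotheses (mu : measurable_fun setT u) (u0 : forall z, (0 <= u z)%R).
Hypothesis nuE : forall A, measurable A ->
  nu A = \int[leb01_sq]_(z in A) (u z)%:E.

Lemma leb01_unit_itvC : leb01 (~` `[0%R, 1%R]) = 0.
Proof. by rewrite leb01E setICl measure0. Qed.

Lemma density_unit_square : nu (unit_square R) = 1.
Proof.
have mI := @measurable_unit_itv R.
have m1 : measurable (fst @^-1` `[0%R, 1%R] : set (plane R)).
  by rewrite -[X in measurable X]setTI; exact: measurable_fst.
have m2 : measurable (snd @^-1` `[0%R, 1%R] : set (plane R)).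
  by rewrite -[X in measurable X]setTI; exact: measurable_snd.
have mIC : measurable (~` `[0%R, 1%R] : set RR) by exact: measurableC.
rewrite unit_squareE measureI_conull//; last first.
  by rewrite preimage_setC; exact: (density_null_snd mu nuE mIC leb01_unit_itvC).
rewrite -[fst @^-1` _]setTI measureI_conull//; first exact: probability_setT.
by rewrite preimage_setC; exact: (density_null_fst mu nuE mIC leb01_unit_itvC).
Qed.

Lemma ge0_integral_unit_square (f : plane R -> \bar R) :
  measurable_fun setT f -> (forall z, 0 <= f z) ->
  \int[nu]_(z in unit_square R) f z = \int[nu]_z f z.
Proof.
move=> mf f0.
have mC : measurable (~` unit_square R).
  by apply: measurableC; exact: measurable_unit_square.
have nC : nu (~` unit_square R) = 0.
  rewrite probability_setC; last exact: measurable_unit_square.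
  by rewrite density_unit_square subee.
by rewrite [RHS](ge0_negligible_integral mC)// setDE setCK setTI.
Qed.

Definition inversion_region (x y : R) : set (plane R) :=
  [set q | (q.1 < x)%R /\ (y < q.2)%R].

Lemma measurable_inversion_region x y : measurable (inversion_region x y).
Proof.
rewrite (_ : inversion_region x y = `]-oo, x[ `*` `]y, +oo[).
  by apply: measurableX; exact: measurable_itv.
apply/seteqP; split => q; rewrite /inversion_region /= !in_itv/= andbT.
  by case.
by case.
Qed.

(** Replacing [q.1 <= x] by [q.1 < x] removes a vertical line, which is null because [nu] has a
    density. *)
Lemma inversion_regionE x y :
  nu (inversion_region x y) = (marg1 nu x - cumul nu x y)%:E.
Proof.
have mQ := measurable_quadrant x y.
have mF := measurable_fst_ray x.
have mS := measurable_snd_ray y.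
have mx : measurable (fst @^-1` [set x] : set (plane R)).
  by rewrite -[X in measurable X]setTI; exact: measurable_fst.
rewrite EFinB marg1E cumulE.
have -> : nu (fst @^-1` `]-oo, x]) - nu (`]-oo, x] `*` `]-oo, y]) =
    nu ((fst @^-1` `]-oo, x]) `\` (snd @^-1` `]-oo, y])).
  rewrite [RHS]measureD//; last by rewrite -ge0_fin_numE// fin_num_measure.
rewrite -[RHS](@measureI_conull _ _ _ nu (~` (fst @^-1` [set x])))//.
- congr (nu _); apply/seteqP; split => q /=.
    rewrite /inversion_region/= !in_itv/= => -[q1 q2]; split.
      by split; [exact: ltW|apply/negP; rewrite -ltNge].
    by move=> qx; move: q1; rewrite qx ltxx.
  rewrite !in_itv/= => -[[q1 /negP]]; rewrite -ltNge => q2 /eqP q3.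
  by split => //; rewrite lt_neqAle q3.
- exact: measurableC.
- exact: measurableD.
rewrite setCK; exact: (density_null_fst mu nuE (measurable_set1 _) (leb01_set1 _)).
Qed.

Lemma cumul_le_marg1 x y : (cumul nu x y <= marg1 nu x)%R.
Proof. by rewrite -subr_ge0 -lee_fin -inversion_regionE. Qed.

Lemma marg1_cumul_le1 x y : (marg1 nu x - cumul nu x y <= 1)%R.
Proof. by rewrite lerBlDr (le_trans (marg1_le1 nu x))// lerDl cumul_ge0. Qed.

(** Pairs whose second point lies strictly to the upper left of the first. A pair is an inversion
    exactly when it or its swap belongs to [S]. *)
Let S : set (plane R * plane R) :=
  [set p | (p.2.1 < p.1.1)%R] `&` [set p | (p.1.2 < p.2.2)%R].

Let mS : measurable S.
Proof.
have mc i j : measurable_fun setT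
    (fun p : plane R * plane R => (if j then fst else snd) (if i then p.1 else p.2)).
  apply: measurableT_comp; first by case: j; [exact: measurable_fst|exact: measurable_snd].
  by case: i; [exact: measurable_fst|exact: measurable_snd].
apply: measurableI.
  rewrite (_ : [set _ | _] = ~` [set p | (p.1.1 <= p.2.1)%R]); last first.
    by apply/seteqP; split => p /=; rewrite ltNge => /negP.
  apply: measurableC; rewrite -[X in measurable X]setTI.
  exact: measurable_fun_le (mc true true) (mc false true).
rewrite (_ : [set _ | _] = ~` [set p | (p.2.2 <= p.1.2)%R]); last first.
  by apply/seteqP; split => p /=; rewrite ltNge => /negP.
apply: measurableC; rewrite -[X in measurable X]setTI.
exact: measurable_fun_le (mc false false) (mc true false).
Qed.

Let inversionE p q : (inversion p q)%:E = (\1_S (p, q))%:E + (\1_S (q, p))%:E :> \bar R.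
Proof.
rewrite /inversion !indicE -EFinD; congr EFin.
rewrite (_ : ((p, q) \in S) = (q.1 < p.1)%R && (p.2 < q.2)%R); last first.
  by apply/idP/idP; rewrite inE; [move=> -[/= -> ->]|move=> /andP[]].
rewrite (_ : ((q, p) \in S) = (p.1 < q.1)%R && (q.2 < p.2)%R); last first.
  by apply/idP/idP; rewrite inE; [move=> -[/= -> ->]|move=> /andP[]].
have [pq1|qp1|->] := ltgtP p.1 q.1; rewrite /=; last by rewrite subrr mul0r ltxx addr0.
  rewrite nmulr_rlt0 ?subr_lt0// subr_gt0 add0r.
  by case: ifP.
rewrite pmulr_rlt0 ?subr_gt0// subr_lt0 addr0.
by case: ifP.
Qed.

(** The indicator of an inversion is the sum of the indicator of [S] and of its swap. By Tonelli's
    theorem the two have the same integral, which cancels the factor 1/2; integrating one of them in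
    [q] is [inversion_regionE]. *)
Lemma energyE :
  energy nu = \int[nu]_z (marg1 nu z.1 - cumul nu z.1 z.2)%:E.
Proof.
have mS1 : measurable_fun setT (fun p : plane R * plane R => (\1_S p : R)%:E).
  by apply/measurable_EFinP; exact: measurable_indic.
have S0 (p : plane R * plane R) : 0 <= (\1_S p : R)%:E by rewrite lee_fin.
have mswap : measurable_fun setT (fun p : plane R * plane R => (p.2, p.1)).
  exact: measurable_fun_pair.
have mS2 := measurableT_comp mS1 mswap.
have msec1 p : measurable_fun setT (fun q => (\1_S (p, q) : R)%:E).
  exact: measurableT_comp mS1 (measurable_pair1 p).
have msec2 p : measurable_fun setT (fun q => (\1_S (q, p) : R)%:E).
  exact: measurableT_comp mS1 (measurable_pair2 p).
have int1 p : \int[nu]_q (\1_S (p, q))%:E = (marg1 nu p.1 - cumul nu p.1 p.2)%:E.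
  rewrite -inversion_regionE -(setIT (inversion_region _ _)).
  rewrite -[RHS]integral_indic//; last exact: measurable_inversion_region.
have mI1 := measurable_fun_fubini_tonelli_F (m2 := nu) _ mS1 S0.
have mI2 := measurable_fun_fubini_tonelli_G (m1 := nu) _ mS1 S0.
rewrite /energy.
under eq_integral do under eq_integral do rewrite inversionE.
have step p : \int[nu]_(q in unit_square R) ((\1_S (p, q))%:E + (\1_S (q, p))%:E) =
    fubini_F nu (fun p => (\1_S p : R)%:E) p + fubini_G nu (fun p => (\1_S p : R)%:E) p.
  rewrite ge0_integral_unit_square; last 2 first.
  - by apply: emeasurable_funD.
  - by move=> z; rewrite adde_ge0.
  by rewrite ge0_integralD.
under eq_integral do rewrite step.
rewrite ge0_integral_unit_square; last 2 first.
- exact: emeasurable_funD.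
- by move=> z; rewrite adde_ge0// integral_ge0.
rewrite ge0_integralD//; last 2 first.
- by move=> z _; rewrite integral_ge0.
- by move=> z _; rewrite integral_ge0.
rewrite -[X in _ * (_ + X)](fubini_tonelli (fun p => (\1_S p : R)%:E))//.
rewrite /fubini_F.
under [in RHS]eq_integral do rewrite -int1.
set I := \int[nu]_x _.
have -> : I + I = 2%:E * I by rewrite -[X in X + _]mul1e -[X in _ + X]mul1e -ge0_muleDl.
by rewrite muleA -EFinM mulVf// mul1e.
Qed.

End energy_formula.

(** * Logarithms and the pressure *)

Section logarithm.
Context (R : realType).
Local Notation RR := (measurableTypeR R).
Local Notation leb01 := (leb01 R).
Implicit Types x t beta : R.

Lemma ln_leB1 x : (0 < x)%R -> (ln x <= x - 1)%R.
Proof.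
move=> x0; rewrite -[X in ln X](subrK 1%R x) addrC le_ln1Dx//.
by rewrite ltrBrDl subrr.
Qed.

(* Applying [ln_leB1] to the square root gives the defect (sqrt x - 1)^2. *)
Lemma ln_eqB1 x : (0 < x)%R -> ln x = (x - 1)%R -> x = 1%R.
Proof.
move=> x0 lnx; have s0 : (0 < Num.sqrt x)%R by rewrite sqrtr_gt0.
have := ln_leB1 s0; have sx : (Num.sqrt x ^+ 2 = x)%R by rewrite sqr_sqrtr// ltW.
have : ln x = (ln (Num.sqrt x) *+ 2)%R by rewrite -lnXn// sx.
rewrite lnx -{1}sx => h1 h2.
have : ((Num.sqrt x - 1) ^+ 2 <= 0)%R by rewrite mulr2n in h1; nra.
rewrite le_eqVlt ltNge sqr_ge0 orbF sqrf_eq0 subr_eq0 => /eqP s1.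
by rewrite -sx s1 expr1n.
Qed.

Let F t := (t - t * ln t)%R.

Let dF t : (0 < t)%R -> is_derive t 1%R F (- ln t)%R.
Proof.
move=> t0.
have H := is_deriveB (is_derive_id t 1%R)
  (is_deriveM (is_derive_id t 1%R) (is_derive1_ln t0)).
apply: is_derive_eq H _.
by rewrite /GRing.scale/= mulfV ?gt_eqF// mulr1 opprD addrA subrr add0r.
Qed.

Lemma integral_ln_itv (e : R) : (0 < e < 1)%R ->
  \int[lebesgue_measure]_(t in `[e, 1%R]) (- ln t)%:E <= 1.
Proof.
move=> /andP[e0 e1].
have cF t : (0 < t)%R -> {for t, continuous F}.
  move=> t0; apply/differentiable_continuous/derivable1_diffP.
  by have [] := dF t0.
rewrite (@continuous_FTC2 R (fun t => - ln t)%R F)//.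
- rewrite -EFinB lee_fin /F ln1 mulr0 subr0.
  have : (ln e <= 0)%R by rewrite ln_le0// ltW.
  by move=> le0; rewrite gerBl//; nra.
- apply: continuous_in_subspaceT => t; rewrite inE/= in_itv/= => /andP[et _].
  apply: (@continuousN _ R^o); apply: continuous_ln; exact: lt_le_trans et.
- split.
  + move=> t; rewrite in_itv/= => /andP[et _].
    by have [] := dF (lt_trans e0 et).
  + by apply: cvg_at_right_filter; exact: cF.
  + by apply: cvg_at_left_filter; exact: cF.
- move=> t; rewrite in_itv/= => /andP[et _]; rewrite derive1E.
  by have [_ ->] := dF (lt_trans e0 et).
Qed.

(** The integral of [- ln] over ]0, 1] is the limit of those over [1 / (n + 2), 1], each at most 1
    by [integral_ln_itv]. The offset 2 keeps the left end strictly below 1. *)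
Lemma integrable_ln : leb01.-integrable setT (EFin \o (@ln R)).
Proof.
apply/integrableP; split; first by apply/measurable_EFinP; exact: measurable_ln.
apply: (@le_lt_trans _ _ 1); last by rewrite ltry.
have mln D : measurable_fun D (fun t : RR => (- ln t)%:E).
  apply: measurable_funTS; apply/measurable_EFinP; exact: measurableT_comp.
have E : forall D : set RR, D `<=` `[0%R, 1%R] ->
  \int[lebesgue_measure]_(t in D) `|(EFin \o (@ln R)) t| =
  \int[lebesgue_measure]_(t in D) (- ln t)%:E.
  move=> D D01; apply: eq_integral => t; rewrite inE => /D01 /=.
  rewrite in_itv/= => /andP[_ t1].
  by rewrite ler0_norm// ln_le0.
rewrite integralT_leb01 E//.
rewrite -integral_itv_obnd_cbnd//; last exact: mln.
pose Fn n : set RR := `[n.+2%:R^-1, 1%R]%classic%R.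
have FnU : \bigcup_n Fn n = `]0%R, 1%R]%classic.
  apply/seteqP; split => t /=.
    move=> [n _]; rewrite /Fn /= !in_itv/= => /andP[nt ->]; rewrite andbT.
    by apply: lt_le_trans nt; rewrite invr_gt0.
  rewrite in_itv/= => /andP[t0 t1].
  have [n _ /(_ n (leqnn n)) /= nd] := near_infty_natSinv_lt (PosNum t0).
  exists n => //; rewrite /Fn /= in_itv/= t1 andbT (le_trans _ (ltW nd))//.
  by rewrite lef_pV2 ?posrE// ler_nat.
rewrite -FnU.
have ndF : nondecreasing_seq Fn.
  move=> a b ab; apply/subsetPset => t; rewrite /Fn /= !in_itv/= => /andP[h ->].
  by rewrite andbT (le_trans _ h)// lef_pV2 ?posrE// ler_nat.
have mFn n : measurable (Fn n) by exact: measurable_itv.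
have F0 n t : Fn n t -> 0 <= (- ln t)%:E.
  by rewrite /Fn /= in_itv/= => /andP[_ t1]; rewrite lee_fin oppr_ge0 ln_le0.
have := ge0_nondecreasing_set_cvg_integral (mu := lebesgue_measure) ndF mFn
  (fun n => mln (Fn n)) F0.
move/cvge_to_le; apply; near=> n; apply: integral_ln_itv.
by rewrite invr_gt0 ltr0n/= invf_lt1// ltr1n.
Unshelve. all: by end_near. Qed.

(** The integrand of [pressure]; at t = A it is ln (Z / A). The conventions for inverse and
    logarithm at 0 give it its limit value 0 at [t = 0]. *)
Definition zeta beta t : R := ln ((1 - expR (- (beta * t))) / (beta * t)).

Lemma zeta0 beta : zeta beta 0 = 0%R.
Proof. by rewrite /zeta mulr0 invr0 mulr0 ln0. Qed.

Lemma zetaE beta t : beta != 0%R -> (0 < t)%R ->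
  zeta beta t = (ln (expint beta t) - ln t)%R.
Proof.
move=> b0 t0; rewrite -ln_div ?posrE ?expint_gt0//.
by rewrite /zeta /expint invfM mulrA.
Qed.

(** [expint beta t / t] is the mean of [expR (- (beta * s))] over [0, t], so it lies between 1 and
    [expR (- (beta * t))]. [H1] and [H2] derive these bounds from [expR_ge1Dx]. *)
Lemma zeta_bound beta t : beta != 0%R -> (0 <= t <= 1)%R ->
  (`|zeta beta t| <= `|beta|)%R.
Proof.
move=> b0 /andP[]; rewrite le_eqVlt => /predU1P[<-|t0 t1].
  by rewrite zeta0 normr0.
have E0 := expint_gt0 b0 t0.
have Et0 : (0 < expint beta t / t)%R by rewrite divr_gt0.
rewrite zetaE// -ln_div ?posrE//.
have bt : (`|beta * t| <= `|beta|)%R.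
  by rewrite normrM (gtr0_norm t0) ler_piMr.
suff [h1 h2] : (expR (- `|beta|) <= expint beta t / t)%R /\
    (expint beta t / t <= expR `|beta|)%R.
  rewrite ler_norml; apply/andP; split.
    by rewrite -[leLHS]expRK ler_ln ?posrE ?expR_gt0.
  by rewrite -[leRHS]expRK ler_ln ?posrE ?expR_gt0.
have H1 : (beta * t * expR (- (beta * t)) <= 1 - expR (- (beta * t)))%R.
  have := expR_ge1Dx (beta * t)%R; have := expR_gt0 (- (beta * t))%R.
  have : (expR (beta * t) * expR (- (beta * t)) = 1)%R.
    by rewrite -expRD subrr expR0.
  by nra.
have H2 : (1 - expR (- (beta * t)) <= beta * t)%R.
  by have := expR_ge1Dx (- (beta * t))%R; lra.
rewrite ler_pdivlMr// ler_pdivrMr// /expint.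
have eb a : (`|a| <= `|beta|)%R -> (expR (- `|beta|) <= expR a <= expR `|beta|)%R.
  by rewrite !ler_expR -ler_norml.
have /andP[e1 e2] := eb (- (beta * t))%R ltac:(by rewrite normrN).
have e3 : (expR (- `|beta|) <= 1)%R by rewrite -[leRHS]expR0 ler_expR oppr_le0.
have e4 : (1 <= expR `|beta|)%R by rewrite -[leLHS]expR0 ler_expR.
have [bn|bp|/eqP] := ltgtP beta 0%R; last by rewrite (negbTE b0).
  rewrite ler_ndivlMr// ler_ndivrMr//.
  have bt0 : (beta * t < 0)%R by rewrite nmulr_rlt0.
  split; nra.
rewrite ler_pdivlMr// ler_pdivrMr//.
have bt0 : (0 < beta * t)%R by rewrite mulr_gt0.
split; nra.
Qed.

Lemma measurable_zeta beta : measurable_fun setT (zeta beta : R -> R).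
Proof.
apply: measurableT_comp; first exact: measurable_ln.
apply: measurable_funM.
  apply: measurable_funB => //; apply: measurableT_comp => //.
  by apply: measurableT_comp.
by apply: measurableT_comp; [exact: measurable_invr|].
Qed.

Lemma pressureE beta : beta != 0%R ->
  pressure beta = (\int[leb01]_t zeta beta t)%R.
Proof.
by move=> b0; rewrite /pressure (negbTE b0) /Rintegral integralT_leb01.
Qed.

End logarithm.

(** * The rate as a sum of nonnegative gaps *)

Section entropy_gap.
Context (R : realType).
Local Notation RR := (measurableTypeR R).
Local Notation leb01 := (leb01 R).
Local Notation leb01_sq := (leb01_sq R).
Variables (beta : R) (nu : probability (plane R) R) (u : plane R -> R).
Hypothesis b0 : beta != 0%R.
Hypotheses (mu : measurable_fun setT u) (u0 : forall z, (0 <= u z)%R).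
Hypothesis ufin : forall y, \int[leb01]_x (u (x, y))%:E < +oo.
Hypothesis nuE : forall A, measurable A ->
  nu A = \int[leb01_sq]_(z in A) (u z)%:E.
Local Notation w := (cond_density beta nu u).

Definition slice_ratio (z : plane R) : R :=
  (slice_mass u z.1 z.2 / slice_total u z.2)%R.

Let mtotal : measurable_fun setT (fun z : plane R => slice_total u z.2).
Proof. exact: measurableT_comp (measurable_slice_total mu u0) measurable_snd. Qed.

Let minvtotal : measurable_fun setT (fun z : plane R => (slice_total u z.2)^-1)%R.
Proof. exact: measurableT_comp (@measurable_invr R) mtotal. Qed.

Let mratio : measurable_fun setT slice_ratio.
Proof. by apply: measurable_funM => //; exact: measurable_slice_mass. Qed.

Let mmarg : measurable_fun setT (fun z : plane R => marg1 nu z.1).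
Proof. exact: measurableT_comp (measurable_marg1 nu) measurable_fst. Qed.

Let mw := measurable_cond_density beta nu mu u0.

Let mwu : measurable_fun setT (fun z => w z / u z)%R.
Proof.
apply: measurable_funM => //.
exact: measurableT_comp (@measurable_invr R) mu.
Qed.

Let wu0 z : (0 <= w z / u z)%R.
Proof. by rewrite divr_ge0// cond_density_ge0. Qed.

Let invtotal0 y : (0 <= (slice_total u y)^-1)%R.
Proof. by rewrite invr_ge0 slice_total_ge0. Qed.

Let mle0 (f : plane R -> R) : measurable_fun setT f ->
  measurable [set z | (f z <= 0)%R].
Proof.
move=> mf; rewrite -[X in measurable X]setTI.
exact: measurable_fun_le mf (measurable_cst _).
Qed.

(** A test function detecting values [<= 0]. Its integral under [leb01] is 0, so any variable that
    is uniform under [nu] is positive almost everywhere. *)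
Let phi0 (t : RR) : \bar R := (\1_(`]-oo, 0%R]%classic : set RR) t : R)%:E.

Let mphi0 : measurable_fun setT phi0.
Proof. by apply/measurable_EFinP; exact: measurable_indic (measurable_ray _). Qed.

Let phi0_ge0 t : 0 <= phi0 t.
Proof. by rewrite lee_fin. Qed.

Let phi0_int : \int[leb01]_t phi0 t = 0.
Proof.
rewrite integral_indic//.
by rewrite setIT; exact: leb01_le0.
Qed.

Let pos_ae (f : plane R -> R) : measurable_fun setT f ->
  \int[nu]_z phi0 (f z) = 0 -> {ae nu, forall z, (0 < f z)%R}.
Proof.
move=> mf f0; exists [set z | (f z <= 0)%R]; split => //; first exact: mle0.
  have <- : \int[nu]_z (\1_[set z | (f z <= 0)%R] z)%:E = nu [set z | (f z <= 0)%R].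
    by rewrite integral_indic ?setIT//; exact: mle0.
  rewrite -[RHS]f0.
  apply: eq_integral => z _; rewrite /phi0 !indicE.
  rewrite (_ : (z \in _) = (f z \in `]-oo, 0%R]%classic))//.
by move=> z /= /negP; rewrite -leNgt.
Qed.

Lemma density_pos_ae : {ae nu, forall z, (0 < u z)%R}.
Proof.
apply: pos_ae => //; rewrite (ge0_integral_density2 mu u0 nuE)//; last first.
  exact: measurableT_comp mphi0 mu.
apply: integral0_eq => z _; rewrite /phi0 indicE.
case: (boolP (_ \in _)); rewrite ?mul0e// inE/= in_itv/= => uz.
by rewrite mul1e; congr EFin; apply/eqP; rewrite eq_le uz u0.
Qed.

Lemma marg1_pos_ae : {ae nu, forall z, (0 < marg1 nu z.1)%R}.
Proof. by apply: pos_ae => //; rewrite (integral_marg1 mu nuE mphi0 phi0_ge0). Qed.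

Lemma slice_ratio_pos_ae : {ae nu, forall z, (0 < slice_ratio z)%R}.
Proof.
by apply: pos_ae => //; rewrite (integral_slice mu u0 ufin nuE mphi0 phi0_ge0).
Qed.

(** Multiplying w / u by the density gives back w where [u] is nonzero, but 0 where [u] vanishes,
    and w may be positive there. *)
Lemma integral_cond_ratio D : measurable D ->
  \int[nu]_(z in D) (w z / u z)%:E <= \int[leb01_sq]_(z in D) (w z)%:E.
Proof.
move=> mD; rewrite (ge0_integral_density2 mu u0 nuE)//; last 2 first.
- by apply/measurable_EFinP; exact: measurable_funTS.
- by move=> z _; rewrite lee_fin.
apply: ge0_le_integral => //.
- by move=> z _; rewrite mule_ge0 ?lee_fin.
- apply/measurable_EFinP; apply: measurable_funTS; exact: measurable_funM.
- by apply/measurable_EFinP; exact: measurable_funTS.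
move=> z _; rewrite -EFinM lee_fin; have [->|uz] := eqVneq (u z) 0%R.
  by rewrite mulr0 cond_density_ge0.
by rewrite divfK.
Qed.

(** A slice of positive mass contributes m / m = 1, a slice of mass 0 contributes 0. *)
Lemma integral_inv_total (C : set RR) : measurable C ->
  \int[nu]_(z in snd @^-1` C) ((slice_total u z.2)^-1)%:E <= leb01 C.
Proof.
move=> mC.
have mC2 : measurable (snd @^-1` C : set (plane R)).
  by rewrite -[X in measurable X]setTI; exact: measurable_snd.
rewrite (ge0_integral_density2 mu u0 nuE)//; last 2 first.
- by apply/measurable_EFinP; exact: measurable_funTS.
- by move=> z _; rewrite lee_fin.
rewrite integral_mkcond.
set f := (X in integral _ _ X).
rewrite (fubini_tonelli2 f); last 2 first.
- apply/(measurable_restrictT _ mC2); apply: measurable_funTS.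
  by apply/measurable_EFinP; exact: measurable_funM.
- by move=> z; apply: erestrict_ge0 => t _; rewrite mule_ge0 ?lee_fin.
rewrite -[leRHS]mul1e -integral_cst// [leRHS]integral_mkcond.
apply: ge0_le_integral => //.
- move=> y _; apply: integral_ge0 => x _; apply: erestrict_ge0 => t _.
  by rewrite mule_ge0 ?lee_fin.
- apply: measurable_fun_fubini_tonelli_G.
    apply/(measurable_restrictT _ mC2); apply: measurable_funTS.
    by apply/measurable_EFinP; exact: measurable_funM.
  by move=> z; apply: erestrict_ge0 => t _; rewrite mule_ge0 ?lee_fin.
- by apply/(measurable_restrictT _ mC).
move=> y _; rewrite /fubini_G /f [leRHS]patchE; case: ifPn => yC; last first.
  rewrite integral0_eq// => x _; rewrite patchE ifF//.
  by apply/negP; rewrite inE => /= /mem_set; apply/negP.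
under eq_integral => x _.
  rewrite patchE mem_set/=; last by move: yC; rewrite inE.
  over.
rewrite ge0_integralZl//; last 3 first.
- by apply/measurable_EFinP; exact: measurable_slice.
- by move=> x _; rewrite lee_fin.
- by rewrite lee_fin.
rewrite -(slice_totalE u0 ufin) -EFinM lee_fin.
have [->|m0] := eqVneq (slice_total u y) 0%R; first by rewrite mulr0.
by rewrite mulVf.
Qed.

Lemma cond_ratio_le1 : \int[nu]_z (w z / u z)%:E <= 1.
Proof.
rewrite (le_trans (integral_cond_ratio measurableT))//.
rewrite -(leb01T R) -[X in integral _ X _](preimage_setT fst).
exact: cond_density_mass.
Qed.

Lemma inv_total_le1 : \int[nu]_z ((slice_total u z.2)^-1)%:E <= 1.
Proof.
rewrite -(leb01T R) -[X in integral _ X _](preimage_setT snd).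
exact: integral_inv_total.
Qed.

Let ge0_integrable (f : plane R -> R) : measurable_fun setT f ->
  (forall z, (0 <= f z)%R) -> \int[nu]_z (f z)%:E <= 1 ->
  nu.-integrable setT (EFin \o f).
Proof.
move=> mf f0 f1; apply/integrableP; split; first exact/measurable_EFinP.
under eq_integral do rewrite gee0_abs ?lee_fin//.
by rewrite (le_lt_trans f1)// ltry.
Qed.

Lemma integrable_cond_ratio : nu.-integrable setT (EFin \o (fun z => w z / u z)%R).
Proof. exact: ge0_integrable cond_ratio_le1. Qed.

Lemma integrable_inv_total :
  nu.-integrable setT (EFin \o (fun z => (slice_total u z.2)^-1)%R).
Proof. exact: ge0_integrable inv_total_le1. Qed.

(** Extends a uniform law from nonnegative test functions to integrable ones through positive and
    negative parts; it is applied to [ln] and to [zeta beta]. *)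
Let transfer (X : plane R -> R) (f : R -> R) : measurable_fun setT X ->
  (forall phi : RR -> \bar R, measurable_fun setT phi -> (forall x, 0 <= phi x) ->
    \int[nu]_z phi (X z) = \int[leb01]_x phi x) ->
  leb01.-integrable setT (EFin \o f) ->
  nu.-integrable setT (EFin \o (f \o X)) /\
  (\int[nu]_z f (X z) = \int[leb01]_t f t)%R.
Proof.
move=> mX XE /integrableP[mf fi]; split.
  apply/integrableP; split; first exact: measurableT_comp mf mX.
  by rewrite (XE (fun t => `|(f t)%:E|))//; exact: measurableT_comp.
rewrite /Rintegral; congr fine; rewrite [LHS]integralE [RHS]integralE.
have mp := measurable_funepos mf; have mn := measurable_funeneg mf.
congr (_ - _).
  rewrite -(XE _ mp); last by move=> x; exact: funepos_ge0.
  by apply: eq_integral => z _; rewrite !funeposE.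
rewrite -(XE _ mn); last by move=> x; exact: funeneg_ge0.
by apply: eq_integral => z _; rewrite !funenegE.
Qed.

Lemma integrable_ln_marg1 : nu.-integrable setT (EFin \o (fun z => ln (marg1 nu z.1))).
Proof.
by have [] := transfer mmarg (integral_marg1 mu nuE) (integrable_ln R).
Qed.

Lemma integrable_ln_ratio : nu.-integrable setT (EFin \o (fun z => ln (slice_ratio z))).
Proof.
by have [] := transfer mratio (integral_slice mu u0 ufin nuE) (integrable_ln R).
Qed.

Lemma integral_ln_marg1_ratio :
  (\int[nu]_z ln (marg1 nu z.1) = \int[nu]_z ln (slice_ratio z))%R.
Proof.
have [_ ->] := transfer mmarg (integral_marg1 mu nuE) (integrable_ln R).
by have [_ ->] := transfer mratio (integral_slice mu u0 ufin nuE) (integrable_ln R).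
Qed.

Let izeta : leb01.-integrable setT (EFin \o zeta beta).
Proof.
have mz := measurable_zeta beta.
apply/integrableP; split; first exact/measurable_EFinP.
rewrite integralT_leb01.
apply: (@le_lt_trans _ _ (\int[lebesgue_measure]_(t in `[0%R, 1%R]) (`|beta|)%:E)).
  apply: ge0_le_integral => //.
  - by apply: measurable_funTS; apply: measurableT_comp => //; exact/measurable_EFinP.
  - move=> t /=; rewrite in_itv/= => t01; rewrite lee_fin.
    exact: zeta_bound.
rewrite integral_cst//.
by rewrite lte_mul_pinfty ?lee_fin//; exact: lebesgue_unit_itv_lty.
Qed.

Lemma integrable_zeta_marg1 :
  nu.-integrable setT (EFin \o (fun z => zeta beta (marg1 nu z.1))).
Proof. by have [] := transfer mmarg (integral_marg1 mu nuE) izeta. Qed.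

Lemma integral_zeta_marg1 :
  (\int[nu]_z zeta beta (marg1 nu z.1) = pressure beta)%R.
Proof.
have [_ ->] := transfer mmarg (integral_marg1 mu nuE) izeta.
by rewrite pressureE.
Qed.

Lemma integrable_inversions :
  nu.-integrable setT (EFin \o (fun z => marg1 nu z.1 - cumul nu z.1 z.2)%R).
Proof.
apply: ge0_integrable.
- apply: measurable_funB => //; exact: measurable_cumul.
- by move=> z; rewrite subr_ge0 (cumul_le_marg1 mu nuE).
rewrite -[leRHS](probability_setT nu) -[leRHS]mul1e -integral_cst//.
apply: ge0_le_integral => //.
- by move=> z _; rewrite lee_fin subr_ge0 (cumul_le_marg1 mu nuE).
- apply/measurable_EFinP; apply: measurable_funB => //; exact: measurable_cumul.
- by move=> z _; rewrite lee_fin marg1_cumul_le1.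
Qed.

(** Its mean is the rate minus the two mass defects 1 - int w / u dnu and 1 - int 1 / m dnu. It is
    written as a sum of terms that can be integrated one by one; [entropy_gapE] gives the form in
    which it is seen to be nonnegative. The term [ln (u z)] stands apart because its integrability
    depends on the entropy of [nu]. *)
Definition entropy_gap (z : plane R) : R :=
  (ln (u z) + (beta * (marg1 nu z.1 - cumul nu z.1 z.2)
  + (zeta beta (marg1 nu z.1) + (ln (marg1 nu z.1) - ln (slice_ratio z)
  + (w z / u z + ((slice_total u z.2)^-1 - 2))))))%R.

Lemma entropy_gapE z : (0 < u z)%R -> (0 < marg1 nu z.1)%R -> (0 < slice_ratio z)%R ->
  (entropy_gap z = ((w z / u z - 1) - ln (w z / u z))
    + (((slice_total u z.2)^-1 - 1) - ln ((slice_total u z.2)^-1)))%R.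
Proof.
move=> uz Az rz.
have m_gt0 : (0 < slice_total u z.2)%R.
  rewrite lt_def slice_total_ge0// andbT; apply/eqP => m0.
  by move: rz; rewrite /slice_ratio m0 invr0 mulr0 ltxx.
have g_gt0 : (0 < slice_mass u z.1 z.2)%R.
  by move: rz; rewrite /slice_ratio pmulr_lgt0// invr_gt0.
have Z0 := expint_gt0 b0 Az.
have k0 : (0 < cond_factor beta nu z.1)%R by rewrite divr_gt0 ?expR_gt0.
have w0 : (0 < w z)%R.
  by apply: (mulr_gt0 k0); apply: mulr_gt0 => //; exact: expR_gt0.
rewrite ln_div ?posrE// lnV ?posrE//.
rewrite /entropy_gap zetaE// /slice_ratio ln_div ?posrE//.
have -> : ln (w z) = (- (beta * marg1 nu z.1) - ln (expint beta (marg1 nu z.1))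
    + (ln (slice_mass u z.1 z.2) + beta * cumul nu z.1 z.2))%R.
  rewrite /cond_density lnM ?posrE ?mulr_gt0 ?expR_gt0 ?invr_gt0//.
  rewrite [ln (slice_mass _ _ _ * _)]lnM ?posrE ?expR_gt0// expRK.
  by rewrite /cond_factor ln_div ?posrE ?expR_gt0// expRK.
ring.
Qed.

Let i2 : nu.-integrable setT (EFin \o cst 2%R : plane R -> \bar R).
Proof. exact: finite_measure_integrable_cst. Qed.

Let f2 (z : plane R) : R := (beta * (marg1 nu z.1 - cumul nu z.1 z.2))%R.
Let f45 (z : plane R) : R := (ln (marg1 nu z.1) - ln (slice_ratio z))%R.
Let f7 (z : plane R) : R := ((slice_total u z.2)^-1 - 2)%R.
Let f6 (z : plane R) : R := (w z / u z + f7 z)%R.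
Let f4 (z : plane R) : R := (f45 z + f6 z)%R.
Let f3 (z : plane R) : R := (zeta beta (marg1 nu z.1) + f4 z)%R.
Let f1 (z : plane R) : R := (f2 z + f3 z)%R.

Let if2 : nu.-integrable setT (EFin \o f2).
Proof. exact: integrableZl integrable_inversions. Qed.
Let if45 : nu.-integrable setT (EFin \o f45).
Proof. exact: (integrableB measurableT integrable_ln_marg1 integrable_ln_ratio). Qed.
Let if7 : nu.-integrable setT (EFin \o f7).
Proof. exact: (integrableB measurableT integrable_inv_total i2). Qed.
Let if6 : nu.-integrable setT (EFin \o f6).
Proof. exact: (integrableD measurableT integrable_cond_ratio if7). Qed.
Let if4 : nu.-integrable setT (EFin \o f4).
Proof. exact: (integrableD measurableT if45 if6). Qed.
Let if3 : nu.-integrable setT (EFin \o f3).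
Proof. exact: (integrableD measurableT integrable_zeta_marg1 if4). Qed.
Let if1 : nu.-integrable setT (EFin \o f1).
Proof. exact: (integrableD measurableT if2 if3). Qed.

(** This makes no assumption on the entropy, so that where the gap vanishes the integrability of
    [ln (u z)] can be deduced from it. *)
Lemma integrable_entropy_gap_rest :
  nu.-integrable setT (EFin \o (fun z => entropy_gap z - ln (u z))%R).
Proof.
rewrite (_ : (fun _ => _) = f1)//.
by apply/funext => z; rewrite /entropy_gap addrC addKr.
Qed.

Hypothesis iu : nu.-integrable setT (EFin \o (fun z => ln (u z))).

Lemma integrable_entropy_gap : nu.-integrable setT (EFin \o entropy_gap).
Proof. exact: (integrableD measurableT iu if1). Qed.

Lemma integral_entropy_gap :
  (\int[nu]_z entropy_gap z = \int[nu]_z ln (u z) + beta * fine (energy nu) +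
     pressure beta - 2 + \int[nu]_z (w z / u z) + \int[nu]_z (slice_total u z.2)^-1)%R.
Proof.
rewrite /entropy_gap (RintegralD measurableT iu if1) (RintegralD measurableT if2 if3).
rewrite (RintegralD measurableT integrable_zeta_marg1 if4).
rewrite (RintegralD measurableT if45 if6).
rewrite (RintegralD measurableT integrable_cond_ratio if7).
rewrite (RintegralB measurableT integrable_inv_total i2).
rewrite (RintegralB measurableT integrable_ln_marg1 integrable_ln_ratio).
rewrite (RintegralZl beta measurableT integrable_inversions) integral_ln_marg1_ratio.
rewrite integral_zeta_marg1 Rintegral_cst//.
have nuT : fine (nu setT) = 1%R by rewrite probability_setT.
rewrite nuT.
have -> : (\int[nu]_z (marg1 nu z.1 - cumul nu z.1 z.2) = fine (energy nu))%R.
  by rewrite (energyE mu nuE).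
by rewrite /=; ring.
Qed.

End entropy_gap.

(** * Relative entropy in terms of a density *)

Section relative_entropy_density.
Context (R : realType).
Local Notation RR := (measurableTypeR R).
Local Notation leb01 := (leb01 R).
Local Notation leb01_sq := (leb01_sq R).
Local Notation lsq := (lebesgue_square R).
Implicit Types (nu : probability (plane R) R) (u : plane R -> R).

(** The Radon-Nikodym derivative agrees with [u] almost everywhere, and [lne] can be replaced by
    [ln] because [u] is positive [nu]-almost everywhere. *)
Lemma relative_entropyE nu u : measurable_fun setT u -> (forall z, (0 <= u z)%R) ->
  (forall A, measurable A -> nu A = \int[leb01_sq]_(z in A) (u z)%:E) ->
  relative_entropy nu lsq = - \int[nu]_z (ln (u z))%:E.
Proof.
move=> mu u0 nuE.
have dom : nu `<< lsq.
  apply/null_content_dominatesP => A mA A0.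
  by rewrite (density_null mu nuE)// -lebesgue_squareE.
rewrite /relative_entropy; case: asboolP => // _; congr (- _).
have iRN := @Radon_Nikodym_integrable _ _ _ (charge_of_finite_measure nu) lsq dom.
have mRN := @Radon_Nikodym_integral _ _ _ (charge_of_finite_measure nu) lsq.
have finRN z := @Radon_Nikodym_fin_num _ _ _ (charge_of_finite_measure nu) lsq z dom.
set f := Radon_Nikodym _ _ in iRN mRN finRN *.
have mf : measurable_fun setT f by exact: measurable_int iRN.
have lneE z : lne (f z) = if (fine (f z) <= 0)%R then -oo else (ln (fine (f z)))%:E.
  by rewrite -[in LHS](fineK (finRN z)).
have mff : measurable_fun setT (fine \o f) by exact: measurableT_comp.
have fu : ae_eq lsq setT f (EFin \o u).
  apply: integral_ae_eq => //.
  - exact/measurable_EFinP.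
  - move=> E _ mE; rewrite -mRN//.
    by rewrite integral_lebesgue_square -nuE.
apply: ae_eq_integral => //.
- under eq_fun do rewrite lneE.
  apply: measurable_fun_ifT.
  + exact: measurable_fun_ler.
  + exact: measurable_cst.
  + by apply/measurable_EFinP; exact: measurableT_comp (@measurable_ln R) mff.
- by apply/measurable_EFinP; exact: measurableT_comp (@measurable_ln R) mu.
case: fu => N [mN N0 subN].
case: (density_pos_ae mu u0 nuE) => M [mM M0 subM].
exists (N `|` M); split; first exact: measurableU.
  apply/eqP; rewrite -measure_le0 (le_trans (measureU2 _ _ _))//.
  have nuN : nu N = 0 by apply: (density_null mu nuE) => //; rewrite -lebesgue_squareE.
  by rewrite [X in X + _]nuN [X in _ + X]M0 adde0.
move=> z /= H; apply: contrapT => /not_orP[Nz Mz]; apply: H => _.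
have fz : f z = (u z)%:E by apply: contrapT => H; apply: Nz; apply: subN => /(_ I).
have uz : (0 < u z)%R by apply: contrapT => H; apply: Mz; apply: subM.
by rewrite fz lne_EFin.
Qed.

(** By Tonelli's theorem almost every slice of the Radon-Nikodym derivative has a finite integral.
    Putting the density to 0 on the null set [N] of the other ordinates yields finiteness for every
    [y]. *)
Lemma density_exists nu : nu `<< lsq -> exists u,
  [/\ measurable_fun setT u, (forall z, (0 <= u z)%R),
      (forall y, \int[leb01]_x (u (x, y))%:E < +oo) &
      forall A, measurable A -> nu A = \int[leb01_sq]_(z in A) (u z)%:E].
Proof.
move=> dom.
pose f := Radon_Nikodym_SigmaFinite.f nu lsq.
have f0 z : 0 <= f z by exact: Radon_Nikodym_SigmaFinite.f_ge0.
have ffin z : f z \is a fin_num by exact: Radon_Nikodym_SigmaFinite.f_fin_num.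
have mf : measurable_fun setT f.
  exact: (measurable_int lsq (Radon_Nikodym_SigmaFinite.f_integrable dom)).
have fE A : measurable A -> nu A = \int[leb01_sq]_(z in A) f z.
  move=> mA; rewrite -integral_lebesgue_square.
  exact: (Radon_Nikodym_SigmaFinite.f_integral dom mA).
pose G := fubini_G leb01 f.
have mG : measurable_fun setT G by exact: measurable_fun_fubini_tonelli_G.
have G0 y : 0 <= G y by exact: integral_ge0.
have iG : leb01.-integrable setT G.
  apply/integrableP; split => //.
  under eq_integral do rewrite gee0_abs//.
  rewrite -(fubini_tonelli2 (m1 := leb01) (m2 := leb01) f)//.
  have := fE setT measurableT; rewrite probability_setT => h.
  by apply: (@le_lt_trans _ _ 1); [rewrite h|rewrite ltry].
pose N : set RR := G @^-1` [set +oo].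
have mN : measurable N.
  by rewrite -[X in measurable X]setTI; apply: mG => //; exact: emeasurable_set1.
have N0 : leb01 N = 0.
  have [M [mM M0 subM]] := integrable_ae measurableT iG.
  apply: (subset_measure0 mN mM) => // y Ny; apply: subM => /(_ I).
  by rewrite Ny.
pose u z := (fine (f z) * \1_(~` (snd @^-1` N)) z)%R.
have mN2 : measurable (snd @^-1` N : set (plane R)).
  by rewrite -[X in measurable X]setTI; exact: measurable_snd.
have mu : measurable_fun setT u.
  apply: measurable_funM; first exact: measurableT_comp.
  by apply: measurable_indic; exact: measurableC.
have u0 z : (0 <= u z)%R by rewrite mulr_ge0// fine_ge0.
exists u; split => //.
- move=> y; have [yN|yN] := pselect (N y).
    rewrite integral0_eq ?ltry// => x _; rewrite /u indicE memNset ?mulr0//=.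
  apply: (@le_lt_trans _ _ (G y)).
    apply: ge0_le_integral => //.
    + by move=> x _; rewrite lee_fin.
    + by apply/measurable_EFinP; exact: measurable_slice.
    + exact: measurableT_comp mf (measurable_pair2 y).
    move=> x _; rewrite /u EFinM fineK// indicE.
    by case: (_ \in _); rewrite ?mule1// mule0.
  by rewrite ltey; apply/eqP => Gy; exact: yN.
move=> A mA; rewrite fE//.
apply: ge0_ae_eq_integral => //.
- exact: measurable_funTS.
- by apply/measurable_EFinP; exact: measurable_funTS.
- by move=> z _; rewrite lee_fin.
exists (snd @^-1` N); split => //; first by rewrite leb01_sq_snd.
move=> z /= H; apply: contrapT => Nz; apply: H => _.
by rewrite /u indicE mem_set//= mulr1 fineK.
Qed.

End relative_entropy_density.

(** * Finiteness of energy and entropy at a zero of the rate *)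

Section zero_rate.
Context (R : realType).
Local Notation RR := (measurableTypeR R).
Local Notation leb01 := (leb01 R).
Local Notation leb01_sq := (leb01_sq R).
Local Notation lsq := (lebesgue_square R).
Implicit Types (nu : probability (plane R) R) (u : plane R -> R).

(** Enlarging the function enlarges the set of simple functions below it. This form applies directly
    to the inner integral of the energy. *)
Lemma ge0_le_integral_nomeas d (T : measurableType d) (mu : {measure set T -> \bar R})
    (D : set T) (f g : T -> \bar R) :
  (forall x, D x -> 0 <= f x) -> (forall x, D x -> f x <= g x) ->
  \int[mu]_(x in D) f x <= \int[mu]_(x in D) g x.
Proof.
move=> f0 fg.
have g0 x : D x -> 0 <= g x by move=> Dx; rewrite (le_trans (f0 x Dx))// fg.
rewrite !ge0_integralE//; apply: le_ereal_sup => _ [h /= hf <-]; exists h => //= x.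
apply: (le_trans (hf x)); rewrite !patchE; case: ifPn => //.
by rewrite inE; exact: fg.
Qed.

Lemma energy_ge0 nu : 0 <= energy nu.
Proof.
rewrite mule_ge0// ?lee_fin// integral_ge0// => p _; rewrite integral_ge0// => q _.
by rewrite lee_fin /inversion; case: ifP.
Qed.

Lemma energy_lty nu : energy nu < +oo.
Proof.
have inv01 p q : 0 <= (@inversion R p q)%:E <= 1.
  by rewrite !lee_fin /inversion; case: ifP; rewrite ?lexx ?ler01.
have mS := @measurable_unit_square R.
have cst1 : \int[nu]_(_ in unit_square R) (1 : \bar R) <= 1.
  by rewrite integral_cst// mul1e probability_le1.
rewrite lte_mul_pinfty// ?lee_fin//; apply: (@le_lt_trans _ _ 1); last by rewrite ltry.
apply: le_trans cst1; apply: ge0_le_integral_nomeas => p _.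
  by apply: integral_ge0 => q _; case/andP: (inv01 p q).
apply: (@le_trans _ _ (\int[nu]_(_ in unit_square R) (1 : \bar R))).
  by apply: ge0_le_integral_nomeas => q _; case/andP: (inv01 p q).
by rewrite integral_cst// mul1e probability_le1.
Qed.

(** Energy and pressure are finite, so a zero rate forces the relative entropy to be finite: [nu]
    then has a density, and the integral of [ln (u z)] is a finite number. *)
Lemma rate_function_fin beta nu : rate_function beta nu = 0 ->
  exists u, [/\ measurable_fun setT u, (forall z, (0 <= u z)%R),
      (forall y, \int[leb01]_x (u (x, y))%:E < +oo),
      (forall A, measurable A -> nu A = \int[leb01_sq]_(z in A) (u z)%:E) &
      nu.-integrable setT (EFin \o (fun z => ln (u z))) /\
      (\int[nu]_z ln (u z) + beta * fine (energy nu) + pressure beta = 0)%R].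
Proof.
have Efin : energy nu = (fine (energy nu))%:E.
  by rewrite fineK// ge0_fin_numE ?energy_ge0// energy_lty.
rewrite /rate_function Efin => rate0.
have dom : nu `<< lsq.
  apply: contrapT => ndom; move: rate0; rewrite /relative_entropy.
  by case: asboolP.
have [u [mu u0 ufin nuE]] := density_exists dom.
exists u; split => //.
move: rate0; rewrite (relative_entropyE mu u0 nuE) oppeK.
have mlnu : measurable_fun setT (fun z => ln (u z)).
  exact: measurableT_comp (@measurable_ln R) mu.
move=> rate0.
have lnfin : \int[nu]_z (ln (u z))%:E \is a fin_num.
  by case: (\int[nu]_z (ln (u z))%:E) rate0.
split; last first.
  move: rate0; rewrite /Rintegral -[X in X + _ + _](fineK lnfin) -!EFinD.
  by case.
apply/integrableP; split; first exact/measurable_EFinP.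
by rewrite integral_fin_num_abs.
Qed.

End zero_rate.

Lemma ae_eq0_integral_le0 d (T : measurableType d) (R : realType)
    (m : {measure set T -> \bar R}) (f : T -> R) :
  m.-integrable setT (EFin \o f) -> {ae m, forall x, (0 <= f x)%R} ->
  (\int[m]_x f x <= 0)%R -> {ae m, forall x, f x = 0%R}.
Proof.
move=> fi f0 fle; have /integrableP[mf _] := fi.
have mabs : measurable_fun setT (fun x => `|(f x)%:E|) by exact: measurableT_comp.
have absE : \int[m]_x `|(f x)%:E| = \int[m]_x (f x)%:E.
  apply: ae_eq_integral => //; case: f0 => N [mN N0 subN]; exists N; split => //.
  by move=> x /= H; apply: subN => /= fx; apply: H => _; rewrite ger0_norm.
have : \int[m]_x `|(f x)%:E| = 0.
  apply/eqP; rewrite eq_le integral_ge0// andbT absE.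
  by rewrite -(fineK (integrable_fin_num measurableT fi)) lee_fin.
move=> abs0; have /(_ abs0) [N [mN N0 subN]] := (ae_eq_integral_abs m measurableT mf).1.
exists N; split => //.
by move=> x /= H; apply: subN => /= /(_ Logic.I) [fx]; apply: H.
Qed.

(** Meant for the values of two measures on a set and on its complement: it turns a one-sided bound
    between them into an equality. *)
Lemma eq_of_le_total (R : realType) (a b c d : \bar R) :
  a + c = 1 -> a <= b -> c <= d -> b + d <= 1 -> 0 <= a -> 0 <= c -> a = b.
Proof.
move=> ac ab cd bd a0 c0; apply/eqP; rewrite eq_le ab/=.
have cfin : c \is a fin_num.
  by rewrite ge0_fin_numE// (@le_lt_trans _ _ 1) ?ltry// -ac leeDr.
by rewrite -(leeD2rE _ _ cfin) ac (le_trans _ bd)// leeD2l.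
Qed.

Lemma probability_le_eq d (T : measurableType d) (R : realType)
    (P : probability T R) (Q : set T -> \bar R) (A : set T) : measurable A ->
  P A <= Q A -> P (~` A) <= Q (~` A) -> Q A + Q (~` A) <= 1 -> P A = Q A.
Proof.
move=> mA PA PAC Q1; apply: (eq_of_le_total _ PA PAC Q1) => //.
by rewrite probability_setC// addeC subeK ?fin_num_measure.
Qed.

(** * Distribution functions of zeros of the rate *)

Section zero_rate_cdf.
Context (R : realType).
Local Notation RR := (measurableTypeR R).
Local Notation leb01 := (leb01 R).
Local Notation leb01_sq := (leb01_sq R).
Variables (beta : R) (nu : probability (plane R) R) (u : plane R -> R).
Hypothesis b0 : beta != 0%R.
Hypotheses (mu : measurable_fun setT u) (u0 : forall z, (0 <= u z)%R).
Hypothesis ufin : forall y, \int[leb01]_x (u (x, y))%:E < +oo.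
Hypothesis nuE : forall A, measurable A ->
  nu A = \int[leb01_sq]_(z in A) (u z)%:E.
Local Notation w := (cond_density beta nu u).
Hypothesis iu : nu.-integrable setT (EFin \o (fun z => ln (u z))).
Hypothesis rate0 :
  (\int[nu]_z ln (u z) + beta * fine (energy nu) + pressure beta = 0)%R.

Let gap_pieces z : (0 < u z)%R -> (0 < marg1 nu z.1)%R -> (0 < slice_ratio u z)%R ->
  (0 < w z / u z /\ 0 < (slice_total u z.2)^-1)%R.
Proof.
move=> uz Az rz.
have m0 : (0 < (slice_total u z.2)^-1)%R.
  rewrite lt_def invr_ge0 slice_total_ge0// andbT; apply/eqP => m0.
  by move: rz; rewrite /slice_ratio m0 mulr0 ltxx.
split => //; rewrite divr_gt0//; apply: mulr_gt0.
  by rewrite divr_gt0 ?expR_gt0// expint_gt0.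
rewrite mulr_gt0 ?expR_gt0//.
by move: rz; rewrite /slice_ratio pmulr_lgt0.
Qed.

(** At rate 0 the mean of the gap is int w / u dnu + int 1 / m dnu - 2, which is at most 0, while
    the gap is nonnegative almost everywhere. Both of its terms therefore vanish, and [ln_eqB1]
    gives the equality case. *)
Let gap0 : {ae nu, forall z, (w z / u z = 1 /\ (slice_total u z.2)^-1 = 1)%R}.
Proof.
have P1 := density_pos_ae mu u0 nuE.
have P2 := marg1_pos_ae mu nuE.
have P3 := slice_ratio_pos_ae mu u0 ufin nuE.
have P4 : {ae nu, forall z, entropy_gap beta nu u z = 0%R}.
  apply: ae_eq0_integral_le0.
  - exact: (integrable_entropy_gap b0 mu u0 ufin nuE iu).
  - apply: filterS3 P1 P2 P3 => z uz Az rz.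
    rewrite (entropy_gapE b0 u0 uz Az rz).
    have [r0 s0] := gap_pieces uz Az rz.
    by rewrite addr_ge0// subr_ge0 ln_leB1.
  rewrite (integral_entropy_gap b0 mu u0 ufin nuE iu) rate0.
  have W1 : (\int[nu]_z (w z / u z) <= 1)%R.
    have fin := integrable_fin_num measurableT (integrable_cond_ratio b0 mu u0 ufin nuE).
    by rewrite -lee_fin /Rintegral fineK//; exact: cond_ratio_le1.
  have M1 : (\int[nu]_z (slice_total u z.2)^-1 <= 1)%R.
    have fin := integrable_fin_num measurableT (integrable_inv_total mu u0 ufin nuE).
    by rewrite -lee_fin /Rintegral fineK//; exact: inv_total_le1.
  by move: W1 M1; lra.
have P5 : {ae nu, forall z,
    [/\ (0 < u z)%R, (0 < marg1 nu z.1)%R & (0 < slice_ratio u z)%R]}.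
  by apply: filterS3 P1 P2 P3.
apply: filterS2 P4 P5 => z gz [uz Az rz].
move: gz; rewrite (entropy_gapE b0 u0 uz Az rz).
have [r0 s0] := gap_pieces uz Az rz.
have := ln_leB1 r0; have := ln_leB1 s0 => h1 h2 h3.
by split; apply: ln_eqB1 => //; move: h1 h2 h3; lra.
Qed.

Let nu_integral1 (f : plane R -> R) A : measurable A -> measurable_fun setT f ->
  (forall z, (0 <= f z)%R) -> {ae nu, forall z, f z = 1%R} ->
  nu A = \int[nu]_(z in A) (f z)%:E.
Proof.
move=> mA mf f0 f1; rewrite -[LHS]mul1e -integral_cst//.
apply: ge0_ae_eq_integral => //.
- by apply/measurable_EFinP; exact: measurable_funTS.
- by move=> z _; rewrite lee_fin.
by apply: filterS f1 => z -> _.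
Qed.

Let nu_le_w A : measurable A -> nu A <= \int[leb01_sq]_(z in A) (w z)%:E.
Proof.
move=> mA; apply: le_trans (integral_cond_ratio b0 mu u0 nuE mA).
rewrite (@nu_integral1 (fun z => w z / u z)%R A)//.
- apply: measurable_funM; first exact: measurable_cond_density.
  exact: measurableT_comp (@measurable_invr R) mu.
- by move=> z; rewrite divr_ge0// cond_density_ge0.
- by apply: filterS gap0 => z [].
Qed.

Let nu_snd_le (C : set RR) : measurable C -> nu (snd @^-1` C) <= leb01 C.
Proof.
move=> mC; apply: le_trans (integral_inv_total mu u0 ufin nuE mC).
rewrite (@nu_integral1 (fun z => (slice_total u z.2)^-1)%R)//.
- by rewrite -[X in measurable X]setTI; exact: measurable_snd.
- apply: measurableT_comp (@measurable_invr R) _.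
  exact: measurableT_comp (measurable_slice_total mu u0) measurable_snd.
- by move=> z; rewrite invr_ge0 slice_total_ge0.
- by apply: filterS gap0 => z [].
Qed.

Let mw := measurable_cond_density beta nu mu u0.

(** A priori w could carry additional mass on a [nu]-null set. Its total mass being at most 1, the
    bound [nu_le_w] on [A] and on its complement rules this out. *)
Lemma zero_rate_density A : measurable A ->
  nu A = \int[leb01_sq]_(z in A) (w z)%:E.
Proof.
move=> mA; have mAC := measurableC mA.
apply: (@probability_le_eq _ _ _ _ (fun A => \int[leb01_sq]_(z in A) (w z)%:E)) => //.
- exact: nu_le_w.
- exact: nu_le_w.
rewrite -ge0_integral_setU//.
- rewrite setUv -(leb01T R) -[X in integral _ X _](preimage_setT fst).
  exact: cond_density_mass.
- by rewrite setUv; exact/measurable_EFinP.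
- by move=> z _; rewrite lee_fin cond_density_ge0.
- by rewrite disj_set2E setICr.
Qed.

Let leb01_setU_le (A : set RR) : measurable A -> leb01 A + leb01 (~` A) <= 1.
Proof.
move=> mA; rewrite -measureU ?setICr//; last exact: measurableC.
rewrite setUv le_eqVlt; apply/orP; left; apply/eqP; exact: leb01T.
Qed.

(** The columns of w have mass at most 1, so the first marginal is bounded by [leb01] on every Borel
    set; both are probabilities and hence agree. *)
Lemma zero_rate_marg1 x : (0 <= x <= 1)%R -> marg1 nu x = x.
Proof.
move=> x01; rewrite /marg1 -[RHS]/(fine x%:E) -leb01_itvNy//; congr fine.
have mR := measurable_ray x.
have le1 (C : set RR) : measurable C -> nu (fst @^-1` C) <= leb01 C.
  move=> mC; apply: le_trans (cond_density_mass b0 mu u0 ufin nuE mC).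
  apply: nu_le_w; rewrite -[X in measurable X]setTI; exact: measurable_fst.
apply: (@eq_of_le_total _ _ _ (nu (fst @^-1` (~` `]-oo, x])))
  (leb01 (~` `]-oo, x]))) => //.
- rewrite -preimage_setC probability_setC; last exact: measurable_fst_ray.
  by rewrite addeC subeK// fin_num_measure//; exact: measurable_fst_ray.
- exact: le1.
- by apply: le1; exact: measurableC.
- exact: leb01_setU_le.
Qed.

(** The same mass comparison, drawn from m = 1 instead of w = u. It supplies the end condition of
    the differential equation. *)
Lemma zero_rate_marg2 y : (0 <= y <= 1)%R -> cumul nu 1 y = y.
Proof.
move=> y01; have mR := measurable_ray y.
have -> : cumul nu 1 y = fine (nu (snd @^-1` `]-oo, y])).
  rewrite /cumul; congr fine.
  rewrite (_ : _ `*` _ = (snd @^-1` `]-oo, y]) `&` (fst @^-1` `]-oo, 1%R])); last first.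
    by apply/seteqP; split => z [].
  rewrite measureI_conull//; [exact: measurable_fst_ray|exact: measurable_snd_ray|].
  rewrite preimage_setC setCitvl; apply: (density_null_fst mu nuE).
    exact: measurable_itv.
  exact: leb01_gt1.
rewrite -[RHS]/(fine y%:E) -leb01_itvNy//; congr fine.
apply: (@eq_of_le_total _ _ _ (nu (snd @^-1` (~` `]-oo, y])))
  (leb01 (~` `]-oo, y]))) => //.
- rewrite -preimage_setC probability_setC; last exact: measurable_snd_ray.
  by rewrite addeC subeK// fin_num_measure//; exact: measurable_snd_ray.
- exact: nu_snd_le.
- by apply: nu_snd_le; exact: measurableC.
- exact: leb01_setU_le.
Qed.

(** The differential equation in integrated form: [integral_cond_density] on the quadrant, with A(s)
    = s. *)
Lemma zero_rate_cumul x y : (0 <= x <= 1)%R ->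
  (cumul nu x y)%:E = \int[lebesgue_measure]_(s in `[0%R, x])
   (expR (- (beta * s)) / expint beta s * ((expR (beta * cumul nu s y) - 1) / beta))%:E.
Proof.
move=> /andP[x0 x1]; rewrite cumulE zero_rate_density; last exact: measurable_quadrant.
rewrite (integral_cond_density b0 mu u0 ufin nuE); last exact: measurable_ray.
rewrite integral_leb01.
rewrite (_ : _ `&` _ = `[0%R, x]%classic); last first.
  apply/seteqP; split => s /=; rewrite !in_itv/=; first by move=> [-> /andP[->]].
  by move=> /andP[-> sx]; rewrite sx (le_trans sx).
apply: eq_integral => s; rewrite inE/= in_itv/= => /andP[s0 sx].
by rewrite /cond_factor zero_rate_marg1// s0 (le_trans sx).
Qed.

(** The quadrant gains at most the mass of the vertical strip over ]x, x'], itself at most the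
    width. The resulting continuity of F in x is what allows differentiating the integral
    equation. *)
Lemma cumul_lipschitz x x' y : (x <= x')%R ->
  (0 <= cumul nu x' y - cumul nu x y <= x' - x)%R.
Proof.
move=> xx'; apply/andP; split.
  rewrite subr_ge0 -lee_fin !cumulE le_measure ?inE//; try exact: measurable_quadrant.
  by apply: setSX => //; exact: subset_itvl.
apply: (@le_trans _ _ (marg1 nu x' - marg1 nu x)%R).
  (* A - F is the mass of an inversion region, which grows with the abscissa. *)
  suff : (marg1 nu x - cumul nu x y <= marg1 nu x' - cumul nu x' y)%R by lra.
  rewrite -lee_fin -!(inversion_regionE mu nuE) le_measure ?inE//;
    try exact: measurable_inversion_region.
  by move=> q [q1 q2]; split => //; exact: lt_le_trans q1 xx'.
have mi : measurable (`]x, x']%classic : set RR) by exact: measurable_itv.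
have nui : nu (fst @^-1` `]x, x']) <= (x' - x)%:E.
  have mi2 : measurable (fst @^-1` `]x, x'] : set (plane R)).
    by rewrite -[X in measurable X]setTI; exact: measurable_fst.
  apply: (le_trans (nu_le_w mi2)).
  apply: (le_trans (cond_density_mass b0 mu u0 ufin nuE mi)).
  have h : lebesgue_measure (`]x, x']%classic : set RR) = (x' - x)%:E.
    by rewrite lebesgue_measure_itv/= lte_fin; case: ltgtP xx' => // <-; rewrite subrr.
  by rewrite leb01E -h measureIl.
rewrite lerBlDl -lee_fin EFinD !marg1E.
rewrite (_ : fst @^-1` `]-oo, x'] =
    (fst @^-1` `]-oo, x]) `|` (fst @^-1` `]x, x'])); last first.
  rewrite -preimage_setU; congr (_ @^-1` _).
  by rewrite -itv_bndbnd_setU.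
rewrite (le_trans (measureU2 _ _ _))//.
- exact: measurable_fst_ray.
- by rewrite -[X in measurable X]setTI; exact: measurable_fst.
- by rewrite leeD2l.
Qed.

End zero_rate_cdf.

(** * Uniqueness for the differential equation *)

Section liouville_ode.
Context (R : realType).
Local Notation RR := (measurableTypeR R).
Local Notation lambda := (@lebesgue_measure R).
Implicit Types (beta x y t : R).

Lemma is_derive_inv (g : R -> R) x dg : g x != 0%R -> is_derive x 1%R g dg ->
  is_derive x 1%R (fun t => (g t)^-1)%R (- (g x) ^- 2 * dg)%R.
Proof.
move=> gx [dgx <-]; apply: DeriveDef; first exact: derivableV.
by rewrite deriveV.
Qed.

Lemma is_derive_expRN beta (g : R -> R) x dg : is_derive x 1%R g dg ->
  is_derive x 1%R (fun t => 1 - expR (- (beta * g t)))%R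
    (beta * dg * expR (- (beta * g x)))%R.
Proof.
move=> dg'.
have H1 : is_derive x 1%R (fun t => (- beta) * g t)%R (- beta * dg)%R.
  exact: is_deriveZ.
have H2 := @is_derive1_comp _ expR (fun t => - beta * g t)%R x _ _ (is_derive_expR _) H1.
have H3 := is_deriveB (is_derive_cst (1%R : R) x 1%R) H2.
rewrite (_ : (fun t => _) = (cst 1 - expR \o (fun t => - beta * g t))%R); last first.
  by apply/funext => t /=; rewrite mulNr.
apply: is_derive_eq H3 _.
by rewrite sub0r mulNr; ring.
Qed.

Lemma one_expRN_neq0 beta x : beta != 0%R -> x != 0%R ->
  (1 - expR (- (beta * x)) != 0)%R.
Proof.
move=> b0 x0; rewrite subr_eq0 eq_sym; apply/eqP => h.
have := @expR_inj R _ 0%R (etrans h (esym (expR0 R))).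
by move/eqP; rewrite oppr_eq0 mulf_eq0 (negbTE b0) (negbTE x0).
Qed.

(** For nonzero [beta] and [s] this is (e^(beta f(s)) - 1) / (e^(beta s) - 1), in the shape in which
    [zero_rate_cumul] produces it. *)
Definition ode_rhs beta (f : R -> R) s : R :=
  (expR (- (beta * s)) / expint beta s * ((expR (beta * f s) - 1) / beta))%R.

Variables (beta y : R) (f : R -> R).
Hypothesis b0 : beta != 0%R.
Hypothesis f0 : forall x, (0 <= f x)%R.
Hypothesis flip : forall x x', (x <= x')%R -> (0 <= f x' - f x <= x' - x)%R.
Hypothesis f1 : f 1 = y.
Hypothesis fE : forall x, (0 <= x <= 1)%R ->
  (f x)%:E = \int[lambda]_(s in `[0%R, x]) (ode_rhs beta f s)%:E.

Let fcont : continuous f.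
Proof.
move=> x; apply/cvgrPdist_le => /= e e0; near=> t.
have dist : (`|x - t| <= e)%R by near: t; exact: cvgr_dist_le.
apply: le_trans dist.
have [xt|tx] := leP x t.
  have /andP[h1 h2] := flip xt.
  by rewrite distrC ger0_norm// distrC ger0_norm ?subr_ge0.
have /andP[h1 h2] := flip (ltW tx).
by rewrite ger0_norm// ger0_norm ?subr_ge0// ltW.
Unshelve. all: by end_near. Qed.

Let expint_cont s : {for s, continuous (expint beta)}.
Proof.
apply/differentiable_continuous/derivable1_diffP.
have H := is_derive_expRN beta (is_derive_id s 1%R).
rewrite /expint; under eq_fun do rewrite mulrC.
by have [] := is_deriveZ (beta^-1)%R H.
Qed.

Let rhs_cont s : (0 < s)%R -> {for s, continuous (ode_rhs beta f)}.
Proof.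
move=> s0; rewrite /ode_rhs.
have E0 : expint beta s != 0%R by rewrite gt_eqF// expint_gt0.
have c1 : {for s, continuous (fun s => expR (- (beta * s)))}.
  apply: (@continuous_comp _ _ _ (fun s => - (beta * s))%R expR).
    by apply: (@continuousN _ R^o); apply: (@continuousM R); [exact: cst_continuous|].
  exact: continuous_expR.
have c2 : {for s, continuous (fun s => (expint beta s)^-1)%R}.
  by apply: cvgV => //; exact: expint_cont.
have c3 : {for s, continuous (fun s => (expR (beta * f s) - 1) / beta)%R}.
  apply: (@continuousM R); last exact: cst_continuous.
  apply: (@continuousB _ R^o); last exact: cst_continuous.
  apply: (@continuous_comp _ _ _ (fun s => beta * f s)%R expR); last first.
    exact: continuous_expR.
  by apply: (@continuousM R); [exact: cst_continuous|exact: fcont].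
exact: (continuousM (continuousM c1 c2) c3).
Qed.

Let rhs_ge0 s : (0 <= s)%R -> (0 <= ode_rhs beta f s)%R.
Proof.
move=> s0; rewrite /ode_rhs; apply: mulr_ge0.
  by rewrite divr_ge0 ?expR_ge0 ?expint_ge0.
have -> : ((expR (beta * f s) - 1) / beta = expR (beta * f s) * expint beta (f s))%R.
  by rewrite /expint mulrA mulrBr mulr1 -expRD subrr expR0.
by rewrite mulr_ge0 ?expR_ge0// expint_ge0.
Qed.

(** Despite the vanishing denominator at 0: the right-hand side is nonnegative on [0,1] and its
    integral there is [f 1] by [fE]. *)
Let rhs_int : lambda.-integrable `[0%R, 1%R] (EFin \o ode_rhs beta f).
Proof.
apply/integrableP; split.
  apply/measurable_EFinP; apply: measurable_funM.
    apply: measurable_funM.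
      apply: measurableT_comp => //; apply: measurable_funTS.
      by apply: measurableT_comp => //; exact: measurable_funM.
    apply: measurable_funTS; apply: measurableT_comp (@measurable_invr R) _.
    exact: measurable_expint.
  apply: measurable_funTS; apply: measurable_funM => //; apply: measurable_funB => //.
  apply: measurableT_comp => //; apply: measurable_funM => //.
  exact: continuous_measurable_fun.
under eq_integral => s.
  rewrite inE/= in_itv/= => /andP[s0 _].
  rewrite ger0_norm; last exact: rhs_ge0.
  over.
by rewrite -fE ?ltry// ler01 lexx.
Qed.

Let f_derive x : (0 < x < 1)%R -> is_derive x 1%R f (ode_rhs beta f x).
Proof.
move=> /andP[x0 x1].
have [dF F'] := continuous_FTC1_closed x1 rhs_int x0 (rhs_cont x0).
have : is_derive x 1%R (fun x => \int[lambda]_(t in [set` `[0%R, x]]) ode_rhs beta f t)%R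
    (ode_rhs beta f x).
  by apply: DeriveDef; [exact: dF|rewrite -derive1E; exact: F'].
apply: near_eq_is_derive; near=> t.
have t01 : (0 <= t <= 1)%R.
  apply/andP; split; first by apply: ltW; near: t; exact: lt_nbhsr.
  by apply: ltW; near: t; exact: lt_nbhsl.
by rewrite /Rintegral -fE.
Unshelve. all: by end_near. Qed.

(** The equation is separable, and ln |1 - e^(-beta r)| / beta is an antiderivative of 1 / (e^(beta
    r) - 1). [q] is the resulting first integral, in a form that makes sense also where f is 0. *)
Let q t : R := ((1 - expR (- (beta * f t))) * (1 - expR (- (beta * t)))^-1)%R.

Let q_derive x : (0 < x < 1)%R -> is_derive x 1%R q 0%R.
Proof.
move=> x01; have x_neq0 : x != 0%R by case/andP: x01 => x0 _; rewrite gt_eqF.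
have D0 := one_expRN_neq0 b0 x_neq0.
have H1 := is_derive_expRN beta (f_derive x01).
have H2 := @is_derive_inv (fun t => 1 - expR (- (beta * t)))%R x _ D0
  (is_derive_expRN beta (is_derive_id x 1%R)).
apply: is_derive_eq (is_deriveM H1 H2) _.
rewrite /GRing.scale/= /ode_rhs /expint.
have e1 : (expR (beta * f x) * expR (- (beta * f x)) = 1)%R.
  by rewrite -expRD subrr expR0.
have e2 : (expR (- (beta * f x)) != 0)%R by rewrite gt_eqF// expR_gt0.
have -> : (expR (beta * f x) = (expR (- (beta * f x)))^-1)%R.
  by rewrite -expRN opprK.
by field; rewrite D0 b0 e2.
Qed.

Let q_const x : (0 < x <= 1)%R -> q x = q 1%R.
Proof.
move=> /andP[x0 x1].
have cq : {within `[x, 1%R], continuous q}.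
  apply: continuous_in_subspaceT => t; rewrite inE/= in_itv/= => /andP[xt _].
  have t0 : t != 0%R by rewrite gt_eqF// (lt_le_trans x0).
  have D0 := one_expRN_neq0 b0 t0.
  have ct : {for t, continuous (fun t => 1 - expR (- (beta * t)))%R}.
    apply/differentiable_continuous/derivable1_diffP.
    by have [] := is_derive_expRN beta (is_derive_id t 1%R).
  have cn : {for t, continuous (fun t => 1 - expR (- (beta * f t)))%R}.
    apply: (@continuous_comp _ _ _ f (fun s => 1 - expR (- (beta * s)))%R).
      exact: fcont.
    apply/differentiable_continuous/derivable1_diffP.
    by have [] := is_derive_expRN beta (is_derive_id (f t) 1%R).
  have cd : {for t, continuous (fun t => (1 - expR (- (beta * t)))^-1)%R}.
    exact: cvgV.
  exact: (continuousM cn cd).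
have dq t : t \in `]x, 1%R[ -> is_derive t 1%R q (cst 0%R t).
  rewrite in_itv/= => /andP[xt t1]; apply: q_derive.
  by rewrite t1 andbT (lt_trans x0).
have [c _] := MVT_segment x1 dq cq.
by rewrite mul0r => /eqP; rewrite subr_eq0 => /eqP.
Qed.

(** [q] is constant on ]0, 1] and [f 1 = y] gives its value; solving for [f x] yields [R_]. At the
    singular point 0 the value of [f] is read off [fE]. *)
Lemma liouville_ode_unique x : (0 <= x <= 1)%R -> f x = R_ beta x y.
Proof.
move=> /andP[]; rewrite le_eqVlt => /predU1P[<- _|x0 x1].
  have := fE (x := 0%R); rewrite lexx ler01 => /(_ erefl).
  rewrite set_itv1 integral_set1 => -[->].
  by rewrite /R_ (negbTE b0) mulr0 oppr0 expR0 subrr !mul0r subr0 ln1 mulr0.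
have := q_const (x := x); rewrite x0 x1 => /(_ erefl).
rewrite /q f1 mulr1 => qE.
have D0 : (1 - expR (- (beta * x)) != 0)%R by rewrite one_expRN_neq0// gt_eqF.
have : (1 - expR (- (beta * f x)) = (1 - expR (- (beta * x))) *
    (1 - expR (- (beta * y))) / (1 - expR (- beta)))%R.
  by rewrite -[LHS](mulfK D0) mulrAC qE; ring.
move=> h; rewrite /R_ (negbTE b0) -h opprB addrCA subrr addr0 expRK.
by rewrite mulrN mulNr opprK mulKf.
Qed.

End liouville_ode.

(** * Densities with w = u and m = 1 have rate zero *)

Section fixed_point_zero_rate.
Context (R : realType).
Local Notation RR := (measurableTypeR R).
Local Notation leb01 := (leb01 R).
Local Notation leb01_sq := (leb01_sq R).
Variables (beta : R) (nu : probability (plane R) R) (u : plane R -> R).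
Hypothesis b0 : beta != 0%R.
Hypotheses (mu : measurable_fun setT u) (u0 : forall z, (0 <= u z)%R).
Hypothesis ufin : forall y, \int[leb01]_x (u (x, y))%:E < +oo.
Hypothesis nuE : forall A, measurable A ->
  nu A = \int[leb01_sq]_(z in A) (u z)%:E.
Local Notation w := (cond_density beta nu u).
Hypothesis wu : {ae nu, forall z, w z = u z}.
Hypothesis total1 : {ae nu, forall z, slice_total u z.2 = 1%R}.

Let gap0 : {ae nu, forall z, entropy_gap beta nu u z = 0%R}.
Proof.
have P1 : {ae nu, forall z,
    [/\ (0 < u z)%R, (0 < marg1 nu z.1)%R & (0 < slice_ratio u z)%R]}.
  by apply: filterS3 (density_pos_ae mu u0 nuE) (marg1_pos_ae mu nuE)
    (slice_ratio_pos_ae mu u0 ufin nuE).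
apply: filterS3 P1 wu total1 => z [uz Az rz] wz tz.
rewrite (entropy_gapE b0 u0 uz Az rz) wz tz divff ?gt_eqF// invr1 ln1.
by rewrite subrr subr0 addr0.
Qed.

Let integral_ae1 (f : plane R -> R) : measurable_fun setT f ->
  {ae nu, forall z, f z = 1%R} -> (\int[nu]_z f z = 1)%R.
Proof.
move=> mf f1; rewrite /Rintegral (@ae_eq_integral _ _ _ _ setT (cst 1))//.
- rewrite integral_cst// mul1e -[RHS]/(fine (1 : \bar R)).
  by congr fine; exact: probability_setT.
- exact/measurable_EFinP.
- by apply: filterS f1 => z -> _.
Qed.

(** As the gap is 0 almost everywhere, [ln (u z)] is the opposite of the remaining terms, which are
    integrable. *)
Let iu : nu.-integrable setT (EFin \o (fun z => ln (u z))).
Proof.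
have irest := integrable_entropy_gap_rest b0 mu u0 ufin nuE.
apply/integrableP; split.
  by apply/measurable_EFinP; exact: measurableT_comp (@measurable_ln R) mu.
have /integrableP[mrest] := irest.
rewrite (_ : \int[nu]_z `|(EFin \o _) z| = \int[nu]_z `|(ln (u z))%:E|)//.
apply: ae_eq_integral => //.
- exact: measurableT_comp.
- apply: measurableT_comp => //; apply/measurable_EFinP.
  exact: measurableT_comp (@measurable_ln R) mu.
by apply: filterS gap0 => z /= -> _; rewrite sub0r normrN.
Qed.

(** The gap is 0 and both mass integrals are exactly 1, so [integral_entropy_gap] reads 0 = rate - 2
    + 1 + 1. *)
Lemma fixed_point_zero_rate : rate_function beta nu = 0.
Proof.
have Efin : energy nu = (fine (energy nu))%:E.
  by rewrite fineK// ge0_fin_numE ?energy_ge0// energy_lty.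
have lnfin := integrable_fin_num measurableT iu.
rewrite /rate_function (relative_entropyE mu u0 nuE) oppeK Efin.
rewrite -[X in X + _ + _](fineK lnfin) -!EFinD; congr EFin.
have P1 := density_pos_ae mu u0 nuE.
have minvu := measurableT_comp (@measurable_invr R) mu.
have W1 : (\int[nu]_z (w z / u z) = 1)%R.
  apply: integral_ae1.
    by apply: measurable_funM => //; exact: measurable_cond_density.
  by apply: filterS2 P1 wu => z uz ->; rewrite divff// gt_eqF.
have M1 : (\int[nu]_z (slice_total u z.2)^-1 = 1)%R.
  apply: integral_ae1.
    apply: measurableT_comp (@measurable_invr R) _.
    exact: measurableT_comp (measurable_slice_total mu u0) measurable_snd.
  by apply: filterS2 P1 total1 => z _ ->; rewrite invr1.
have := integral_entropy_gap b0 mu u0 ufin nuE iu; rewrite W1 M1.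
rewrite [LHS](_ : _ = 0%R); first by rewrite /Rintegral; lra.
rewrite /Rintegral (@ae_eq_integral _ _ _ _ setT (cst 0))//.
- by rewrite integral0.
- exact: measurable_int (integrable_entropy_gap b0 mu u0 ufin nuE iu).
- by apply: filterS gap0 => z -> _.
Qed.

End fixed_point_zero_rate.

(** * The density of R_beta *)

Section mallows_density.
Context (R : realType).
Variable beta : R.
Hypothesis b0 : beta != 0%R.
Implicit Types x y t : R.

Definition oneE x : R := (1 - expR (- (beta * x)))%R.

Definition mallows_den x y : R := (oneE 1 - oneE x * oneE y)%R.

(** The derivative of [R_ beta x] at [y], that is, the g belonging to the density of R_beta. *)
Definition mallows_slice x y : R :=
  (oneE x * expR (- (beta * y)) / mallows_den x y)%R.

Definition mallows_rho x y : R :=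
  (beta * oneE 1 * expR (- (beta * x)) * expR (- (beta * y)) / mallows_den x y ^+ 2)%R.

Lemma oneE_expint x : oneE x = (beta * expint beta x)%R.
Proof. by rewrite /oneE /expint mulrCA divff// mulr1. Qed.

Lemma oneE1_neq0 : oneE 1 != 0%R.
Proof. by rewrite one_expRN_neq0// oner_eq0. Qed.

Lemma oneE0 : oneE 0 = 0%R.
Proof. by rewrite oneE_expint expint0 mulr0. Qed.

Lemma is_derive_oneE x : is_derive x 1%R oneE (beta * expR (- (beta * x)))%R.
Proof.
apply: is_derive_eq (is_derive_expRN beta (is_derive_id x 1%R)) _.
by rewrite mulr1.
Qed.

Lemma expint_le x : (0 <= x <= 1)%R -> (0 <= expint beta x <= expint beta 1)%R.
Proof.
move=> /andP[x0 x1]; rewrite expint_ge0//= -subr_ge0.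
have -> : (expint beta 1 - expint beta x = expR (- (beta * x)) * expint beta (1 - x))%R.
  have key : (expR (- (beta * 1)) =
      expR (- (beta * x)) * expR (- (beta * (1 - x))))%R.
    by rewrite -expRD; congr expR; ring.
  by rewrite /expint key; ring.
by rewrite mulr_ge0 ?expR_ge0// expint_ge0// subr_ge0.
Qed.

(** For either sign of [beta], [oneE x / oneE 1] is a ratio of values of [expint] and lies in [0,1],
    while [oneE y] is below 1. *)
Lemma mallows_log_arg_gt0 x y : (0 <= x <= 1)%R -> (0 <= y <= 1)%R ->
  (0 < 1 - oneE x * oneE y / oneE 1)%R.
Proof.
move=> x01 y01; have /andP[ex0 ex1] := expint_le x01.
have E1 : (0 < expint beta 1)%R by exact: expint_gt0.
have -> : (oneE x * oneE y / oneE 1 = expint beta x / expint beta 1 * oneE y)%R.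
  rewrite (oneE_expint x) (oneE_expint 1); field.
  by rewrite b0 gt_eqF.
have r0 : (0 <= expint beta x / expint beta 1)%R by rewrite divr_ge0// ltW.
have r1 : (expint beta x / expint beta 1 <= 1)%R by rewrite ler_pdivrMr// mul1r.
have y1 : (oneE y < 1)%R by rewrite /oneE ltrBlDr ltrDl expR_gt0.
rewrite subr_gt0; have [ey|ey] := leP (oneE y) 0%R.
  by rewrite (le_lt_trans _ ltr01)// mulr_ge0_le0.
by rewrite (le_lt_trans _ y1)// ler_piMl// ltW.
Qed.

Lemma mallows_denE x y :
  (mallows_den x y = oneE 1 * (1 - oneE x * oneE y / oneE 1))%R.
Proof. by rewrite mulrBr mulr1 [X in _ = (_ - X)%R]mulrC divfK ?oneE1_neq0. Qed.

Lemma mallows_den_neq0 x y : (0 < 1 - oneE x * oneE y / oneE 1)%R ->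
  mallows_den x y != 0%R.
Proof. by move=> h; rewrite mallows_denE mulf_neq0 ?oneE1_neq0// gt_eqF. Qed.

Lemma R_E x y : R_ beta x y = (- beta^-1 * ln (1 - oneE x * oneE y / oneE 1))%R.
Proof. by rewrite /R_ (negbTE b0) /oneE mulr1. Qed.

Lemma is_derive_R_ x y : (0 < 1 - oneE x * oneE y / oneE 1)%R ->
  is_derive y 1%R (R_ beta x) (mallows_slice x y).
Proof.
move=> h.
have D0 := mallows_den_neq0 h.
have H1 : is_derive y 1%R (fun t => 1 - oneE x / oneE 1 * oneE t)%R
    (- (oneE x / oneE 1 * (beta * expR (- (beta * y)))))%R.
  have := is_deriveB (is_derive_cst (1%R : R) y 1%R)
    (is_deriveZ (oneE x / oneE 1)%R (is_derive_oneE y)).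
  by rewrite sub0r.
have h' : (0 < 1 - oneE x / oneE 1 * oneE y)%R by rewrite mulrAC.
have H2 := @is_derive1_comp _ (@ln R) (fun t => 1 - oneE x / oneE 1 * oneE t)%R y _ _
  (is_derive1_ln h') H1.
have H3 := is_deriveZ (- beta^-1)%R H2.
rewrite (_ : R_ beta x =
    (fun t => - beta^-1 * ln (1 - oneE x / oneE 1 * oneE t))%R); last first.
  by apply/funext => t; rewrite R_E mulrAC.
apply: is_derive_eq H3 _.
move: D0 oneE1_neq0 h'; rewrite /GRing.scale/= /mallows_slice /mallows_den.
set a := oneE x; set b := oneE y; set c := oneE 1; set e := expR _ => D0 c0 h'.
have -> : (1 - a / c * b = (c - a * b) / c)%R by field.
by field; rewrite b0 c0 D0.
Qed.

Lemma is_derive_mallows_slice x y : mallows_den x y != 0%R ->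
  is_derive x 1%R (fun t => mallows_slice t y) (mallows_rho x y).
Proof.
move=> D0.
have H1 : is_derive x 1%R (fun t => mallows_den t y)
    (- (oneE y * (beta * expR (- (beta * x)))))%R.
  have := is_deriveB (is_derive_cst (oneE 1 : R) x 1%R)
    (is_deriveZ (oneE y)%R (is_derive_oneE x)).
  rewrite sub0r; congr is_derive; apply/funext => t.
  by rewrite /mallows_den mulrC.
have H2 := @is_derive_inv _ (fun t => mallows_den t y) x _ D0 H1.
have H3 := is_deriveZ (expR (- (beta * y)))%R (is_deriveM (is_derive_oneE x) H2).
rewrite (_ : (fun t => _) =
  (expR (- (beta * y)) \*: (oneE * (fun t => (mallows_den t y)^-1)))%R); last first.
  apply/funext => t; rewrite /mallows_slice /= /GRing.scale/=.
  by rewrite mulrA [(_ * oneE t)%R]mulrC.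
apply: is_derive_eq H3 _.
rewrite /GRing.scale/= /mallows_rho.
move: D0; rewrite /mallows_den => D0.
by field.
Qed.

Lemma continuous_oneE : continuous oneE.
Proof.
move=> t; apply/differentiable_continuous/derivable1_diffP.
by have [] := is_derive_oneE t.
Qed.

(** The outer derivative involves the inner one at all abscissas near [x], possibly outside [0,1].
    The argument of the logarithm is continuous, so it stays positive there. *)
Lemma rhoE x y : (0 <= x <= 1)%R -> (0 <= y <= 1)%R ->
  rho beta x y = mallows_rho x y.
Proof.
move=> x01 y01; have h := mallows_log_arg_gt0 x01 y01.
have D0 := mallows_den_neq0 h.
rewrite /rho derive1E.
have : is_derive x 1%R (fun t => derive1 (R_ beta t) y) (mallows_rho x y).
  apply: near_eq_is_derive (is_derive_mallows_slice D0); near=> t.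
  rewrite derive1E; have [|_ ->//] := @is_derive_R_ t y.
  near: t.
  have c : {for x, continuous (fun t => 1 - oneE t * oneE y / oneE 1)%R}.
    apply: (@continuousB _ R^o); first exact: cst_continuous.
    apply: (@continuousM R); last exact: cst_continuous.
    by apply: (@continuousM R); [exact: continuous_oneE|exact: cst_continuous].
  exact: (cvgr_gt _ c).
by case.
Unshelve. all: by end_near. Qed.

(** beta (1 - e^(-beta)) equals beta^2 times [expint beta 1], hence is nonnegative for either sign
    of [beta]. *)
Lemma mallows_rho_ge0 x y : (0 <= mallows_rho x y)%R.
Proof.
apply: divr_ge0; last exact: sqr_ge0.
apply: mulr_ge0; last exact: expR_ge0.
apply: mulr_ge0; last exact: expR_ge0.
rewrite oneE_expint mulrA -expr2 mulr_ge0 ?sqr_ge0//.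
by rewrite expint_ge0.
Qed.

Lemma integral_mallows_rho x y : (0 <= x <= 1)%R -> (0 <= y <= 1)%R ->
  \int[lebesgue_measure]_(t in `[0%R, x]) (mallows_rho t y)%:E = (mallows_slice x y)%:E.
Proof.
move=> /andP[]; rewrite le_eqVlt => /predU1P[<- _|x0 x1] y01.
  by rewrite set_itv1 integral_set1 /mallows_slice oneE0 !mul0r.
have t01 t : (0 <= t <= x)%R -> (0 <= t <= 1)%R.
  by move=> /andP[-> tx]; rewrite (le_trans tx).
have D0 t : (0 <= t <= x)%R -> mallows_den t y != 0%R.
  by move=> /t01 h; exact: mallows_den_neq0 (mallows_log_arg_gt0 h y01).
have cs t : (0 <= t <= x)%R -> {for t, continuous (fun t => mallows_slice t y)}.
  move=> /D0 h; apply/differentiable_continuous/derivable1_diffP.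
  by have [] := is_derive_mallows_slice h.
rewrite (@continuous_FTC2 R _ (fun t => mallows_slice t y))//.
- by rewrite [X in _ - X](_ : _ = 0) ?sube0// /mallows_slice oneE0 !mul0r.
- apply: continuous_in_subspaceT => t; rewrite inE/= in_itv/= => h.
  have cden : {for t, continuous (fun t => mallows_den t y)}.
    apply: (@continuousB _ R^o); first exact: cst_continuous.
    by apply: (@continuousM R); [exact: continuous_oneE|exact: cst_continuous].
  have ce : {for t, continuous (fun t => expR (- (beta * t)))%R}.
    have -> : (fun t => expR (- (beta * t)))%R = (fun t => 1 - oneE t)%R.
      by apply/funext => s; rewrite /oneE opprB addrC subrK.
    by apply: (@continuousB _ R^o); [exact: cst_continuous|exact: continuous_oneE].
  have cinv : {for t, continuous (fun t => (mallows_den t y ^+ 2)^-1)%R}.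
    apply: cvgV; first by rewrite expf_neq0// D0.
    exact: (continuousM cden cden).
  have ck s : {for t, continuous (fun=> s : R)} by exact: cst_continuous.
  exact: (continuousM (continuousM (continuousM (ck (beta * oneE 1)%R) ce)
    (ck (expR (- (beta * y))))) cinv).
- split.
  + move=> t; rewrite in_itv/= => /andP[t0 tx].
    have h : (0 <= t <= x)%R by rewrite !ltW.
    by have [] := is_derive_mallows_slice (D0 t h).
  + by apply: cvg_at_right_filter; apply: cs; rewrite lexx ltW.
  + by apply: cvg_at_left_filter; apply: cs; rewrite lexx ltW.
- move=> t; rewrite in_itv/= => /andP[t0 tx]; rewrite derive1E.
  have h : (0 <= t <= x)%R by rewrite !ltW.
  by have [_ ->] := is_derive_mallows_slice (D0 t h).
Qed.

Lemma R_0 x : R_ beta x 0 = 0%R.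
Proof. by rewrite R_E oneE0 mulr0 mul0r subr0 ln1 mulr0. Qed.

Lemma R_1 x : R_ beta x 1 = x.
Proof.
rewrite R_E mulfK ?oneE1_neq0// /oneE opprB addrCA subrr addr0 expRK.
by rewrite mulrN mulNr opprK mulKf.
Qed.

Lemma integral_mallows_slice x y : (0 <= x <= 1)%R -> (0 <= y <= 1)%R ->
  \int[lebesgue_measure]_(t in `[0%R, y]) (mallows_slice x t)%:E = (R_ beta x y)%:E.
Proof.
move=> x01 /andP[]; rewrite le_eqVlt => /predU1P[<- _|y0 y1].
  by rewrite set_itv1 integral_set1 R_0.
have pos t : (0 <= t <= y)%R -> (0 < 1 - oneE x * oneE t / oneE 1)%R.
  by move=> /andP[t0 ty]; apply: mallows_log_arg_gt0 => //; rewrite t0 (le_trans ty).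
have cR t : (0 <= t <= y)%R -> {for t, continuous (R_ beta x)}.
  move=> /pos h; apply/differentiable_continuous/derivable1_diffP.
  by have [] := is_derive_R_ h.
rewrite (@continuous_FTC2 R _ (R_ beta x))//.
- by rewrite R_0 sube0.
- apply: continuous_in_subspaceT => t; rewrite inE/= in_itv/= => /pos h.
  have ce : {for t, continuous (fun t => expR (- (beta * t)))%R}.
    have -> : (fun t => expR (- (beta * t)))%R = (fun t => 1 - oneE t)%R.
      by apply/funext => s; rewrite /oneE opprB addrC subrK.
    by apply: (@continuousB _ R^o); [exact: cst_continuous|exact: continuous_oneE].
  have ck s : {for t, continuous (fun=> s : R)} by exact: cst_continuous.
  have cden : {for t, continuous (mallows_den x)}.
    exact: (@continuousB _ R^o _ _ _ _ (ck (oneE 1))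
      (continuousM (ck (oneE x)) (@continuous_oneE t))).
  have cinv : {for t, continuous (fun t => (mallows_den x t)^-1)%R}.
    by apply: cvgV => //; exact: mallows_den_neq0.
  exact: (continuousM (continuousM (ck (oneE x)) ce) cinv).
- split.
  + move=> t; rewrite in_itv/= => /andP[t0 ty].
    have h : (0 <= t <= y)%R by rewrite !ltW.
    by have [] := is_derive_R_ (pos t h).
  + by apply: cvg_at_right_filter; apply: cR; rewrite lexx ltW.
  + by apply: cvg_at_left_filter; apply: cR; rewrite lexx ltW.
- move=> t; rewrite in_itv/= => /andP[t0 ty]; rewrite derive1E.
  have h : (0 <= t <= y)%R by rewrite !ltW.
  by have [_ ->] := is_derive_R_ (pos t h).
Qed.

End mallows_density.

Section probability_of_density.
Context d (T : measurableType d) (R : realType).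
Variables (mu : {measure set T -> \bar R}) (f : T -> \bar R).
Variables (mf : measurable_fun setT f) (f0 : forall x, 0 <= f x).

(** A separate name carrying the proof of total mass 1, to which the probability structure is
    attached. *)
Definition pdensity (f1 : \int[mu]_x f x = 1) := mdensity mu mf f0.

Variable f1 : \int[mu]_x f x = 1.

HB.instance Definition _ := Measure.on (pdensity f1).
HB.instance Definition _ :=
  Measure_isProbability.Build _ _ _ (pdensity f1) f1.

End probability_of_density.

(** * Probabilities determined by their distribution function on the square *)

Section unit_square_determined.
Context (R : realType).
Local Notation RR := (measurableTypeR R).

(** The complements ]x, +oo[ of the given rays form a generating pi-system, and finite total mass
    transfers the equality to them. *)
Lemma eq_measure_rays (m1 m2 : {measure set RR -> \bar R}) :
  m1 setT < +oo -> m1 setT = m2 setT ->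
  (forall x, m1 `]-oo, x]%classic = m2 `]-oo, x]%classic) ->
  forall A, measurable A -> m1 A = m2 A.
Proof.
move=> m1oo m12T m12.
have compl (m : {measure set RR -> \bar R}) x : m setT < +oo ->
    m `]x, +oo[%classic = m setT - m `]-oo, x]%classic.
  move=> moo; rewrite -setCitvl -setTD measureD ?setTI//; exact: measurable_ray.
pose g n : set RR := `](- n%:R)%R, +oo[%classic.
have mG : @measurable _ RR = <<s @RGenOInfty.G R >>.
  exact: RGenOInfty.measurableE.
apply: (measure_unique _ g mG) => //=.
- move=> _ _ [x ->] [y ->]; exists (Num.max x y).
  by apply/seteqP; split => z /=; rewrite !in_itv/= !andbT gt_max => /andP.
- by move=> n; exists (- n%:R)%R.
- rewrite -subTset => x _; exists (Num.truncn `|x|%R).+1 => //=.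
  rewrite /g/= in_itv/= andbT ltrNl (le_lt_trans (ler_norm _))// normrN.
  exact: truncnS_gt.
- by move=> _ [x ->]; rewrite !compl -?m12T// m12.
- move=> n; rewrite (le_lt_trans _ m1oo)// le_measure ?inE//.
  exact: measurable_itv.
Qed.

Let clamp x : R := Num.max 0%R (Num.min x 1%R).

Let clamp01 x : (0 <= clamp x <= 1)%R.
Proof. by rewrite /clamp le_max lexx/= ge_max ler01 ge_min lexx orbT. Qed.

(** No mass lies outside ]0, 1], so only the projection of [x] to [0,1] matters. This extends
    equalities known on the square to all of the plane. *)
Lemma measure_ray_clamp (m : {measure set RR -> \bar R}) x :
  m `]-oo, 0%R]%classic = 0 -> m `]1%R, +oo[%classic = 0 ->
  m `]-oo, x]%classic = m `]-oo, clamp x]%classic.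
Proof.
move=> m0 m1; rewrite /clamp; have [x1|x1] := leP x 1%R.
  have [x0|x0] := leP x 0%R => //.
  by rewrite m0; apply: (subset_measure0 _ _ _ m0) => //; exact: subset_itvl.
rewrite max_r ?ler01// -[LHS](@measureI_conull _ _ _ m `]-oo, 1%R]%classic)//.
- congr (m _); apply/seteqP; split => z /=; rewrite !in_itv/=; first by case.
  by move=> z1; rewrite z1 (le_trans z1)// ltW.
- by rewrite setCitvl.
Qed.

(** Equality on quadrants is extended to rectangles one side at a time: with the other side fixed,
    both probabilities define finite measures on the line, determined by rays. Rectangles then
    generate the sigma-algebra. *)
Lemma eq_probability_cumul (P Q : probability (plane R) R) :
  (forall A : set RR, measurable A -> leb01 R A = 0 ->
    [/\ P (fst @^-1` A) = 0, Q (fst @^-1` A) = 0,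
      P (snd @^-1` A) = 0 & Q (snd @^-1` A) = 0]) ->
  (forall x y, (0 <= x <= 1)%R -> (0 <= y <= 1)%R -> cumul P x y = cumul Q x y) ->
  forall A, measurable A -> P A = Q A.
Proof.
move=> nullPQ PQ.
have mf (A : set RR) : measurable A -> measurable (fst @^-1` A : set (plane R)).
  by move=> mA; rewrite -[X in measurable X]setTI; exact: measurable_fst.
have ms (A : set RR) : measurable A -> measurable (snd @^-1` A : set (plane R)).
  by move=> mA; rewrite -[X in measurable X]setTI; exact: measurable_snd.
pose mfst' (N : probability (plane R) R) B (mB : measurable B) :
  {measure set RR -> \bar R} := pushforward (mrestr N mB) fst.
pose msnd' (N : probability (plane R) R) B (mB : measurable B) :
  {measure set RR -> \bar R} := pushforward (mrestr N mB) snd.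
pose mfst := mfst' measurable_fst.
pose msnd := msnd' measurable_snd.
have mfstE (N : probability (plane R) R) B (mB : measurable B) A :
    mfst N B mB A = N (fst @^-1` A `&` B) by [].
have msndE (N : probability (plane R) R) B (mB : measurable B) A :
    msnd N B mB A = N (snd @^-1` A `&` B) by [].
have sub0 (N : probability (plane R) R) A B : measurable A -> measurable B ->
    N A = 0 -> N (A `&` B) = 0.
  move=> mA mB N0; apply: (subset_measure0 _ mA _ N0); last exact: subIsetl.
  exact: measurableI.
have lty (N : probability (plane R) R) A : measurable A -> N A < +oo.
  by move=> mA; rewrite -ge0_fin_numE// fin_num_measure.
have mR (y : R) : measurable (`]-oo, y]%classic : set RR) by exact: measurable_itv.
have mO : measurable (`]1%R, +oo[%classic : set RR) by exact: measurable_itv.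
have [Pf0 Qf0 Ps0 Qs0] := nullPQ _ (mR 0%R) (leb01_le0 R).
have [Pf1 Qf1 Ps1 Qs1] := nullPQ _ mO (leb01_gt1 R).
have quad (N : probability (plane R) R) (x y : R) :
    N (fst @^-1` `]-oo, x] `&` snd @^-1` `]-oo, y]) = (cumul N x y)%:E.
  by rewrite cumulE.
have clampf (N : probability (plane R) R) B (mB : measurable B) (x : R) :
    N (fst @^-1` `]-oo, 0%R]) = 0 ->
    N (fst @^-1` `]1%R, +oo[) = 0 ->
    N (fst @^-1` `]-oo, x] `&` B) = N (fst @^-1` `]-oo, (clamp x)] `&` B).
  move=> N0 N1; rewrite -!(mfstE N B mB); apply: measure_ray_clamp.
    by rewrite mfstE; apply: sub0 => //; exact: mf.
  by rewrite mfstE; apply: sub0 => //; exact: mf.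
have clamps (N : probability (plane R) R) B (mB : measurable B) (x : R) :
    N (snd @^-1` `]-oo, 0%R]) = 0 ->
    N (snd @^-1` `]1%R, +oo[) = 0 ->
    N (snd @^-1` `]-oo, x] `&` B) = N (snd @^-1` `]-oo, (clamp x)] `&` B).
  move=> N0 N1; rewrite -!(msndE N B mB); apply: measure_ray_clamp.
    by rewrite msndE; apply: sub0 => //; exact: ms.
  by rewrite msndE; apply: sub0 => //; exact: ms.
have quadPQ (x y : R) : P (fst @^-1` `]-oo, x] `&` snd @^-1` `]-oo, y]) =
    Q (fst @^-1` `]-oo, x] `&` snd @^-1` `]-oo, y]).
  have my := ms _ (mR y); have mcx := mf _ (mR (clamp x)).
  rewrite (clampf P _ my x Pf0 Pf1) (clampf Q _ my x Qf0 Qf1) setIC.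
  rewrite (clamps P _ mcx y Ps0 Ps1) (clamps Q _ mcx y Qs0 Qs1) setIC.
  by rewrite (quad P) (quad Q) PQ.
have rest1 (N : probability (plane R) R) (B : set (plane R)) :
    measurable B -> N (fst @^-1` `]1%R, +oo[) = 0 ->
    N (fst @^-1` `]-oo, 1%R] `&` B) = N B.
  move=> mB N1; rewrite setIC measureI_conull//; first exact: mf.
  by rewrite preimage_setC setCitvl.
have rest2 (N : probability (plane R) R) (B : set (plane R)) :
    measurable B -> N (snd @^-1` `]1%R, +oo[) = 0 ->
    N (snd @^-1` `]-oo, 1%R] `&` B) = N B.
  move=> mB N1; rewrite setIC measureI_conull//; first exact: ms.
  by rewrite preimage_setC setCitvl.
have step1 (y : R) (A : set RR) : measurable A ->
    P (fst @^-1` A `&` snd @^-1` `]-oo, y]) =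
    Q (fst @^-1` A `&` snd @^-1` `]-oo, y]).
  move=> mA; have my := ms _ (mR y).
  rewrite -(mfstE P _ my) -(mfstE Q _ my); apply: eq_measure_rays => //.
  - by rewrite mfstE preimage_setT setTI; exact: lty.
  - rewrite !mfstE preimage_setT !setTI.
    by rewrite -(rest1 P _ my Pf1) -(rest1 Q _ my Qf1) quadPQ.
  - by move=> x; rewrite !mfstE quadPQ.
have step2 (A B : set RR) : measurable A -> measurable B ->
    P (fst @^-1` A `&` snd @^-1` B) = Q (fst @^-1` A `&` snd @^-1` B).
  move=> mA mB; have mA1 := mf _ mA; rewrite ![fst @^-1` _ `&` _]setIC.
  rewrite -(msndE P _ mA1) -(msndE Q _ mA1); apply: eq_measure_rays => //.
  - by rewrite msndE preimage_setT setTI; exact: lty.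
  - rewrite !msndE preimage_setT !setTI.
    by rewrite -(rest2 P _ mA1 Ps1) -(rest2 Q _ mA1 Qs1) setIC step1// setIC.
  - by move=> y; rewrite !msndE setIC step1// setIC.
pose C : set (set (plane R)) :=
  [set C | exists2 A, measurable A & exists2 B, measurable B & A `*` B = C].
move=> A mA; apply: (measure_unique C (fun=> setT)) => //.
- exact: measurable_prod_measurableType.
- move=> _ _ [A1 mA1 [B1 mB1 <-]] [A2 mA2 [B2 mB2 <-]].
  rewrite -setXI; exists (A1 `&` A2); first exact: measurableI.
  by exists (B1 `&` B2) => //; exact: measurableI.
- by move=> _; exists setT => //; exists setT => //; rewrite setXTT.
- by rewrite bigcup_const//; exists 0%N.
- by move=> _ [A1 mA1 [B1 mB1 <-]]; exact: step2.
- by move=> _; exact: lty.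
Qed.

End unit_square_determined.

(** * The probability with density rho *)

Section mallows_probability.
Context (R : realType).
Local Notation RR := (measurableTypeR R).
Local Notation leb01 := (leb01 R).
Local Notation leb01_sq := (leb01_sq R).
Variable beta : R.
Hypothesis b0 : beta != 0%R.

(* [mallows_rho] may blow up on a curve off the square, hence the cut-off in [y]. *)
Definition strip_density (z : plane R) : R :=
  (mallows_rho beta z.1 z.2 * \1_(`[0%R, 1%R] : set RR) z.2)%R.

Lemma strip_densityE z : (0 <= z.2 <= 1)%R -> strip_density z = mallows_rho beta z.1 z.2.
Proof. by move=> y01; rewrite /strip_density indicE mem_set ?mulr1//= in_itv. Qed.

Lemma strip_density0 z : ~~ (0 <= z.2 <= 1)%R -> strip_density z = 0%R.
Proof.
move=> y01; rewrite /strip_density indicE memNset ?mulr0//= in_itv/=.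
exact/negP.
Qed.

Lemma strip_density_ge0 z : (0 <= strip_density z)%R.
Proof. by rewrite mulr_ge0 ?mallows_rho_ge0// indicE; case: (_ \in _). Qed.

Lemma measurable_strip_density : measurable_fun setT strip_density.
Proof.
have mE (g : plane R -> R) : measurable_fun setT g ->
    measurable_fun setT (fun z => expR (- (beta * g z)))%R.
  move=> mg; apply: measurableT_comp => //; apply: measurableT_comp => //.
  exact: measurable_funM.
have mO (g : plane R -> R) : measurable_fun setT g ->
    measurable_fun setT (fun z => oneE beta (g z)).
  by move=> mg; apply: measurable_funB => //; exact: mE.
have mx : measurable_fun setT (fun z : plane R => z.1 : R) by exact: measurable_fst.
have my : measurable_fun setT (fun z : plane R => z.2 : R) by exact: measurable_snd.
apply: measurable_funM; last first.
  have mI : measurable_fun setT (\1_(`[0%R, 1%R] : set RR) : RR -> R).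
    by apply: measurable_indic; exact: measurable_itv.
  exact: measurableT_comp mI measurable_snd.
apply: measurable_funM.
  apply: measurable_funM; last exact: mE.
  by apply: measurable_funM; [exact: measurable_cst|exact: mE].
apply: (measurableT_comp (@measurable_invr R)).
apply: measurable_funX; apply: measurable_funB => //.
by apply: measurable_funM; exact: mO.
Qed.

Lemma integral_strip_density x y : (0 <= x <= 1)%R -> (0 <= y <= 1)%R ->
  \int[leb01]_(t in `]-oo, x]) (strip_density (t, y))%:E = (mallows_slice beta x y)%:E.
Proof.
move=> x01 y01; rewrite integral_leb01 -integral_mallows_rho//.
rewrite (_ : _ `&` _ = `[0%R, x]%classic); last first.
  apply/seteqP; split => t /=; rewrite !in_itv/=.
    by move=> [-> /andP[->]].
  by move=> /andP[t0 tx]; rewrite t0 tx (le_trans tx)//; case/andP: x01.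
by apply: eq_integral => t _; rewrite strip_densityE.
Qed.

(** The condition m = 1: at x = 1 the denominator of [mallows_slice] factors as
    [oneE beta 1 * expR (- (beta * y))], which is its numerator. *)
Lemma integralT_strip_density y : \int[leb01]_t (strip_density (t, y))%:E =
  (\1_(`[0%R, 1%R] : set RR) y)%:E.
Proof.
have [y01|y01] := boolP (0 <= y <= 1)%R; last first.
  rewrite integral0_eq; last by move=> t _; rewrite strip_density0.
  by rewrite indicE memNset//= in_itv/=; exact/negP.
rewrite indicE mem_set/= ?in_itv//= -[RHS]/(1%R%:E).
have S1 : mallows_slice beta 1 y = 1%R.
  rewrite /mallows_slice (_ : mallows_den _ _ _ = oneE beta 1 * expR (- (beta * y)))%R.
    by rewrite divff// mulf_neq0// ?oneE1_neq0// gt_eqF// expR_gt0.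
  by rewrite /mallows_den [oneE beta y]/oneE; ring.
rewrite -[X in _ = X%:E]S1 -(integral_strip_density _ y01) ?ler01 ?lexx// !integral_leb01.
congr (integral _ _ _); apply/seteqP; split => t /=; rewrite !in_itv/=.
  by move=> [_ t01]; split => //; case/andP: t01.
by move=> [_ t01]; split.
Qed.

Lemma strip_density_fin y : \int[leb01]_x (strip_density (x, y))%:E < +oo.
Proof. by rewrite integralT_strip_density ltry. Qed.

Let mu : measurable_fun setT (EFin \o strip_density).
Proof. by apply/measurable_EFinP; exact: measurable_strip_density. Qed.

Let u0 z : 0 <= (EFin \o strip_density) z.
Proof. by rewrite lee_fin strip_density_ge0. Qed.

Lemma integral_strip_density_quadrant x y : (0 <= x <= 1)%R -> (0 <= y <= 1)%R ->
  \int[leb01_sq]_(z in `]-oo, x] `*` `]-oo, y]) (strip_density z)%:E = (R_ beta x y)%:E.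
Proof.
move=> x01 y01; have mQ := measurable_quadrant x y.
rewrite integral_mkcond; set f := (X in integral _ _ X).
rewrite [LHS](fubini_tonelli2 f); last 2 first.
- by apply/(measurable_restrictT _ mQ); exact: measurable_funTS.
- by move=> z; apply: erestrict_ge0 => t _; exact: u0.
rewrite -(integral_mallows_slice b0 x01 y01).
rewrite (_ : `[0%R, y]%classic = `]-oo, y] `&` `[0%R, 1%R]); last first.
  apply/seteqP; split => t /=; rewrite !in_itv/=; last by move=> [-> /andP[->]].
  by move=> /andP[t0 ty]; rewrite t0 ty (le_trans ty)//; case/andP: y01.
rewrite integralT_leb01 integral_mkcondl; apply: eq_integral => t.
rewrite inE/= in_itv/= => t01; rewrite patchE /fubini_G /f.
case: ifPn => ty; last first.
  rewrite integral0_eq// => s _; rewrite patchE ifF//.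
  by apply/negP; rewrite inE => -[/= _ /mem_set]; apply/negP.
rewrite -(integral_strip_density x01 t01) [RHS]integral_mkcond.
apply: eq_integral => s _; rewrite !patchE.
rewrite (_ : ((s, t) \in _) = (s \in `]-oo, x]%classic))//.
apply/idP/idP; rewrite !inE; first by case.
by move=> sx; split => //; move: ty; rewrite inE.
Qed.

Lemma integralT_strip_density_sq : \int[leb01_sq]_z (strip_density z)%:E = 1.
Proof.
rewrite (fubini_tonelli2 (EFin \o strip_density))// integralT_leb01.
rewrite -[RHS](lebesgue_unit_itv R) -[RHS]mul1e -integral_cst; last first.
  exact: measurable_unit_itv.
apply: eq_integral => y y01; rewrite /fubini_G integralT_strip_density.
by rewrite indicE y01.
Qed.

Definition mallows_prob : probability (plane R) R :=
  pdensity mu u0 integralT_strip_density_sq.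

Let nuE A : measurable A -> mallows_prob A = \int[leb01_sq]_(z in A) (strip_density z)%:E.
Proof. by []. Qed.

Let us := measurable_strip_density.

Lemma cumul_mallows_prob x y : (0 <= x <= 1)%R -> (0 <= y <= 1)%R ->
  cumul mallows_prob x y = R_ beta x y.
Proof.
move=> x01 y01; rewrite /cumul nuE ?integral_strip_density_quadrant//.
exact: measurable_quadrant.
Qed.

Lemma marg1_mallows_prob x : (0 <= x <= 1)%R -> marg1 mallows_prob x = x.
Proof.
move=> x01; rewrite -(cumul1 us nuE) cumul_mallows_prob ?R_1//.
by rewrite ler01 lexx.
Qed.

Lemma mallows_prob_square : mallows_prob (unit_square R) = 1.
Proof. exact: density_unit_square us nuE. Qed.

Lemma mallows_prob_square_ae : {ae mallows_prob, forall z, unit_square R z}.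
Proof.
exists (~` unit_square R); split.
- by apply: measurableC; exact: measurable_unit_square.
- have := @probability_setC _ _ _ mallows_prob _ (@measurable_unit_square R).
  by rewrite mallows_prob_square subee.
- by [].
Qed.

(** The condition w = u, with A(x) = x and e^(-beta F) equal to the argument of the logarithm in
    [R_]. At abscissa 0 it would fail, since [cond_factor] is 0 there. *)
Lemma cond_density_mallows_prob z : unit_square R z -> (0 < z.1)%R ->
  cond_density beta mallows_prob strip_density z = strip_density z.
Proof.
case: z => x y [/=]; rewrite !in_itv/= => x01 y01 x0.
rewrite strip_densityE//= /cond_density /cond_factor/=.
rewrite marg1_mallows_prob// cumul_mallows_prob//.
have -> : slice_mass strip_density x y = mallows_slice beta x y.
  by rewrite /slice_mass integral_strip_density.
have h := mallows_log_arg_gt0 b0 x01 y01.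
rewrite (R_E b0) mulNr mulrN mulVKf// [expR (- ln _)]expRN lnK ?posrE//.
have ox : oneE beta x != 0%R by rewrite one_expRN_neq0// gt_eqF.
have D0 := mallows_den_neq0 b0 h; have o1 := oneE1_neq0 b0.
have -> : expint beta x = (oneE beta x / beta)%R by rewrite (oneE_expint b0) mulrC mulKf.
have -> : (1 - oneE beta x * oneE beta y / oneE beta 1 =
    mallows_den beta x y / oneE beta 1)%R.
  by rewrite (mallows_denE b0) [RHS]mulrC mulKf.
rewrite /mallows_slice /mallows_rho; field.
by rewrite ox b0 D0 o1.
Qed.

Lemma rate_mallows_prob : rate_function beta mallows_prob = 0.
Proof.
have aeF : Filter (almost_everywhere mallows_prob).
  exact: ae_filter_ringOfSetsType.
apply: (fixed_point_zero_rate b0 us strip_density_ge0 strip_density_fin nuE).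
  (* Almost everywhere A(x) > 0, and A(x) = x on the square, so abscissa 0 is avoided. *)
  apply: filterS2 (marg1_pos_ae us nuE) mallows_prob_square_ae => z z0 zs.
  apply: cond_density_mallows_prob => //; case: zs => z1 _.
  by move: z0; rewrite marg1_mallows_prob// -in_itv.
apply: filterS2 mallows_prob_square_ae mallows_prob_square_ae => z _ [_ z2].
by rewrite /slice_total integralT_strip_density indicE mem_set.
Qed.

(** Neither side charges the complement of the square, and on the square [rhoE] identifies the two
    densities. *)
Lemma mallows_probE A : measurable A ->
  mallows_prob A = \int[lebesgue_square R]_(z in A) (rho beta z.1 z.2)%:E.
Proof.
move=> mA; have mS := @measurable_unit_square R.
transitivity (mallows_prob (A `&` unit_square R)).
  rewrite measureI_conull//.
  have := @probability_setC _ _ _ mallows_prob _ mS.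
  by rewrite mallows_prob_square subee.
have mAS : measurable (A `&` unit_square R) by exact: measurableI.
rewrite (nuE mAS).
rewrite -integral_lebesgue_square.
rewrite [LHS](integral_mrestr (lebesgue_plane R) mS).
rewrite [RHS](integral_mrestr (lebesgue_plane R) mS) -setIA setIid.
apply: eq_integral => z; rewrite inE => -[_ []]; rewrite /= !in_itv/= => x01 y01.
by rewrite rhoE// strip_densityE.
Qed.

End mallows_probability.

(** * Uniqueness of the zero, and the case beta = 0 *)

Section zero_rate_unique.
Context (R : realType).
Local Notation RR := (measurableTypeR R).
Local Notation leb01 := (leb01 R).
Local Notation leb01_sq := (leb01_sq R).

(** For each ordinate y in [0,1] the function x |-> F(x, y) solves the differential equation with
    end value y, so F is [R_] on the square. *)
Lemma zero_rate_unique beta (b0 : beta != 0%R) (nu : probability (plane R) R) :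
  rate_function beta nu = 0 ->
  forall A, measurable A -> nu A = mallows_prob b0 A.
Proof.
move=> /rate_function_fin[u [mu u0 ufin nuE [iu rate0]]].
have sE A : measurable A ->
  mallows_prob b0 A = \int[leb01_sq]_(z in A) (strip_density beta z)%:E by [].
have ms := measurable_strip_density beta.
have nulls (A : set RR) : measurable A -> leb01 A = 0 ->
    [/\ nu (fst @^-1` A) = 0, mallows_prob b0 (fst @^-1` A) = 0,
      nu (snd @^-1` A) = 0 & mallows_prob b0 (snd @^-1` A) = 0].
  move=> mA A0; split.
  - exact: density_null_fst mu nuE _ mA A0.
  - exact: density_null_fst ms sE _ mA A0.
  - exact: density_null_snd mu nuE _ mA A0.
  - exact: density_null_snd ms sE _ mA A0.
apply: (eq_probability_cumul nulls) => x y x01 y01; rewrite cumul_mallows_prob//.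
apply: (liouville_ode_unique b0 _ _ _ _ x01 (f := fun x => cumul nu x y)).
- by move=> t; exact: cumul_ge0.
- by move=> s t st; exact: (cumul_lipschitz b0 mu u0 ufin nuE iu rate0).
- exact: (zero_rate_marg2 b0 mu u0 ufin nuE iu rate0).
- by move=> t t01; exact: (zero_rate_cumul b0 mu u0 ufin nuE iu rate0).
Qed.

Lemma rho0 (x y : R) : rho 0 x y = 1%R.
Proof.
rewrite /rho (_ : (fun _ => _) = id) ?derive1_id//.
apply/funext => s; rewrite derive1E (_ : R_ 0 s = s \*: id)%R; last first.
  by apply/funext => t; rewrite /R_ eqxx.
rewrite (@derive_val _ _ _ _ _ _ _ (is_deriveZ s (is_derive_id y 1%R))).
by rewrite /GRing.scale/= mulr1.
Qed.

Let one_ge0 (z : plane R) : (0 : \bar R) <= cst 1 z.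
Proof. by rewrite /= lee01. Qed.

Lemma integral_one_sq : \int[leb01_sq]_z cst 1 z = 1.
Proof.
rewrite integral_cst// mul1e -(preimage_setT fst).
by rewrite -[RHS](leb01T R); exact: leb01_sq_fst.
Qed.

Definition uniform_square : probability (plane R) R :=
  pdensity (measurable_cst 1) one_ge0 integral_one_sq.

Let one (_ : plane R) : R := 1%R.

Let mone : measurable_fun setT one. Proof. exact: measurable_cst. Qed.

Let uE A : measurable A -> uniform_square A = \int[leb01_sq]_(z in A) (one z)%:E.
Proof. by []. Qed.

Lemma uniform_square_square : uniform_square (unit_square R) = 1.
Proof. exact: density_unit_square mone uE. Qed.

Lemma uniform_squareE A : measurable A ->
  uniform_square A = \int[lebesgue_square R]_(z in A) (rho 0 z.1 z.2)%:E.
Proof.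
move=> mA; rewrite integral_lebesgue_square uE//.
by apply: eq_integral => z _; rewrite rho0.
Qed.

Lemma rate_uniform_square : rate_function 0 uniform_square = 0.
Proof.
rewrite /rate_function (relative_entropyE mone _ uE) => [|z]; last exact: ler01.
rewrite oppeK mul0e adde0 /pressure eqxx adde0 integral0_eq// => z _.
by rewrite ln1.
Qed.

(** The rate is the integral of ln u. The nonnegative quantity ln u - 1 + 1 / u then has mean int 1
    / u dnu - 1, which is at most 0, so u = 1 [nu]-almost everywhere; comparing masses on a set and
    its complement turns this into equality of measures. *)
Lemma zero_rate0_unique (nu : probability (plane R) R) :
  rate_function 0 nu = 0 -> forall A, measurable A -> nu A = uniform_square A.
Proof.
move=> /rate_function_fin[u [mu u0 ufin nuE [iu]]].
rewrite mul0r addr0 /pressure eqxx addr0 => lnu0.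
have minv : measurable_fun setT (fun z => (u z)^-1)%R.
  exact: measurableT_comp (@measurable_invr R) mu.
have inv_le A : measurable A -> \int[nu]_(z in A) ((u z)^-1)%:E <= uniform_square A.
  move=> mA; rewrite uE// (ge0_integral_density2 mu u0 nuE)//; last 2 first.
  - by apply/measurable_EFinP; exact: measurable_funTS.
  - by move=> z _; rewrite lee_fin invr_ge0.
  apply: ge0_le_integral => //.
  - by move=> z _; rewrite mule_ge0 ?lee_fin ?invr_ge0.
  - by apply/measurable_EFinP; apply: measurable_funTS; exact: measurable_funM.
  - by apply/measurable_EFinP; exact: measurable_funTS.
  move=> z _; rewrite -EFinM lee_fin; have [->|uz] := eqVneq (u z) 0%R.
    by rewrite mulr0 ler01.
  by rewrite mulVf.
have iinv : nu.-integrable setT (EFin \o (fun z => (u z)^-1)%R).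
  apply/integrableP; split; first exact/measurable_EFinP.
  rewrite (_ : \int[nu]_z _ = \int[nu]_z ((u z)^-1)%:E).
    by rewrite (le_lt_trans (inv_le _ measurableT))// probability_setT ltry.
  by apply: eq_integral => z _; rewrite /= ger0_norm// invr_ge0.
have i1 : nu.-integrable setT (EFin \o cst 1%R).
  by apply: finite_measure_integrable_cst.
have int1 : (\int[nu]_z 1 = 1)%R.
  rewrite Rintegral_cst// mul1r -[RHS]/(fine (1 : \bar R)); congr fine.
  exact: probability_setT.
have inv1 : (\int[nu]_z (u z)^-1 <= 1)%R.
  rewrite /Rintegral -lee_fin fineK; last exact: integrable_fin_num iinv.
  by rewrite (le_trans (inv_le _ measurableT))// probability_setT.
have u1 : {ae nu, forall z, (u z)^-1%R = 1%R}.
  have pos := density_pos_ae mu u0 nuE.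
  suff gap0 : {ae nu, forall z, (ln (u z) - 1 + (u z)^-1 = 0)%R}.
    apply: filterS2 pos gap0 => z uz z0; apply: ln_eqB1; first by rewrite invr_gt0.
    by rewrite lnV ?posrE//; move: z0; lra.
  have iB : nu.-integrable setT (EFin \o (fun z => ln (u z) - 1)%R).
    exact: (integrableB measurableT iu i1).
  apply: ae_eq0_integral_le0.
  - exact: (integrableD measurableT iB iinv).
  - apply: filterS pos => z uz; have /ln_leB1 : (0 < (u z)^-1)%R by rewrite invr_gt0.
    by rewrite lnV ?posrE//; lra.
  - rewrite RintegralD//.
    by rewrite RintegralB// lnu0 int1; move: inv1; lra.
have le A : measurable A -> nu A <= uniform_square A.
  move=> mA; rewrite (_ : nu A = \int[nu]_(z in A) ((u z)^-1)%:E) ?inv_le//.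
  rewrite -[LHS]mul1e -integral_cst//; apply: ae_eq_integral => //.
  - by apply/measurable_EFinP; exact: measurable_funTS.
  - by apply: filterS u1 => z -> _.
move=> A mA; have mAC := measurableC mA.
apply: probability_le_eq => //; [exact: le|exact: le|].
have := @probability_setC _ _ _ uniform_square _ mA => ->.
by rewrite addeC subeK// fin_num_measure.
Qed.

End zero_rate_unique.

Theorem theorem3p11 (R : realType) (beta : R) :
  exists nu_star : probability (plane R) R,
    [/\ square_prob nu_star,
        (forall A : set (plane R), measurable A ->
           nu_star A =
           \int[lebesgue_square R]_(z in A) (rho beta z.1 z.2)%:E),
        rate_function beta nu_star = 0 &
        forall nu : probability (plane R) R,
          square_prob nu -> rate_function beta nu = 0 ->
          forall A : set (plane R), measurable A -> nu A = nu_star A].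
Proof.
have [->|b0] := eqVneq beta 0%R.
  exists (uniform_square R); split.
  - exact: uniform_square_square.
  - exact: uniform_squareE.
  - exact: rate_uniform_square.
  - by move=> nu _ nu0 A mA; exact: zero_rate0_unique.
exists (mallows_prob b0); split.
- exact: mallows_prob_square.
- exact: mallows_probE.
- exact: rate_mallows_prob.
- by move=> nu _ nu0 A mA; exact: zero_rate_unique.
Qed.
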